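(* Let $p=2$ and let $n$ be a positive integer. Let $E_0^{*,*}=\mathrm{Hom}_{C_2}(W_*,D(n,0)^* )$ and $E_0'^{*,*}=\mathrm{Hom}_{C_2}(W_*,D(n,1)^* )$, and let $E_*^{*,*}$, $E_*'^{*,*}$ be the corresponding type I spectral sequences. If $n$ is odd, then $$E_2^{i,j}=\begin{cases}\mathbb Z/n&\text{if }i=j=0,\\0&\text{otherwise,}\end{cases}\qquad E_2'^{i,j}=\begin{cases}\mathbb Z/n&\text{if }i=0,\ j=1,\\0&\text{otherwise,}\end{cases}$$ and both spectral sequences collapse at $E_2$. If $n$ is even, then $$E_2^{i,j}=\begin{cases}\mathbb Z/n&\text{if }i=j=0,\\\mathbb Z/2&\text{if }j=-1\text{ and }i\ge0,\text{ or if }j=0\text{ and }i>0,\\0&\text{otherwise,}\end{cases}$$ $$E_2'^{i,j}=\begin{cases}\mathbb Z/n&\text{if }i=0,\ j=1,\\\mathbb Z/2&\text{if }j=2\text{ and }i\ge0,\text{ or if }j=1\text{ and }i>0,\\0&\text{otherwise.}\end{cases}$$ In this case both spectral sequences collapse at $E_3$, and $$E_3^{i,j}=\begin{cases}\mathbb Z/n&\text{if }i=j=0,\\\mathbb Z/2&\text{if }(i,j)=(0,-1)\text{ or }(1,-1),\text{ or if }i>0\text{ is even and }j=0\text{ or }-1,\\0&\text{otherwise,}\end{cases}$$ $$E_3'^{i,j}=\begin{cases}\mathbb Z/n&\text{if }i=0\text{ and }j=1,\\\mathbb Z/2&\text{if }i\text{ is odd and }j=1\text{ or }2,\\0&\text{otherwise.}\end{cases}$$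 The only non-trivial extension in reassembling $H^*\mathrm{Tot}\,E_0^{*,*}$ and $H^*\mathrm{Tot}\,E_0'^{*,*}$ from the $E_\infty$-pages is that (for $n$ even) the extension with kernel $E_3^{1,-1}$ and quotient $E_3^{0,0}$ is non-split.
   Context: $W_*$ is the integral cellular chain complex of a contractible $C_2$-free $C_2$-CW-complex (so a free resolution of $\mathbb Z$ over $\mathbb ZC_2$), and $\mathrm{Hom}_{C_2}=\mathrm{Hom}_{\mathbb ZC_2}$. For $n>0$, $C(n,k)^*$ is the cochain complex with $C(n,k)^{k-1}=C(n,k)^k=\mathbb Z$, all other groups zero, and differential $C(n,k)^{k-1}\to C(n,k)^k$ multiplication by $n$. $D(n,k)^*=C(n,k)^*\otimes C(n,k)^*$ is the complex of $\mathbb ZC_2$-modules where the generator of $C_2$ acts by $c\otimes c'\mapsto(-1)^{\deg c\deg c'}c'\otimes c$. The double complex $\mathrm{Hom}_{C_2}(W_i,D(n,k)^j)$ has differentials $d$ raising $i$ (from $W_*$) and $d'$ raising $j$ (from $D(n,k)^*$); the type I spectral sequence is the one with $d_0=d'$, so $d_r:E_r^{i,j}\to E_r^{i+r,j-r+1}$ and the $E_2$-page is $H^i(C_2;H^j(D(n,k)^* ))$. $\mathrm{Tot}$ denotes the total complex. *)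

(* Defs.v *)
(* MathComp with classical logic (mathcomp.classical.boolp). *)
From HB Require Import structures.
From mathcomp Require Import all_boot all_order all_algebra.
From mathcomp Require Import ring_quotient boolp functions.

Set Implicit Arguments.
Unset Strict Implicit.
Unset Printing Implicit Defensive.

Import GRing.Theory.

Local Open Scope ring_scope.
Local Open Scope quotient_scope.

Definition isog (A B : zmodType) : Prop :=
  exists f : {additive A -> B}, bijective f.

(* Z/m for m >= 1; unlike 'Z_m this is the zero group when m = 1. *)
Definition Zmod (m : nat) : zmodType := 'I_m.-1.+1.

Section DirectProduct.
Variables (I : Type) (A : I -> zmodType).

Definition dprod : Type := forall i, A i.

HB.instance Definition _ := gen_eqMixin dprod.
HB.instance Definition _ := gen_choiceMixin dprod.

Let add (x y : dprod) : dprod := fun i => x i + y i.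
Let zero : dprod := fun=> 0.
Let opp (x : dprod) : dprod := fun i => - x i.

Let addA : associative add.
Proof. by move=> x y z; apply: functional_extensionality_dep => i; exact: addrA. Qed.
Let addC : commutative add.
Proof. by move=> x y; apply: functional_extensionality_dep => i; exact: addrC. Qed.
Let add0 : left_id zero add.
Proof. by move=> x; apply: functional_extensionality_dep => i; exact: add0r. Qed.
Let addN : left_inverse zero opp add.
Proof. by move=> x; apply: functional_extensionality_dep => i; exact: addNr. Qed.

HB.instance Definition _ := GRing.isZmodule.Build dprod addA addC add0 addN.

Lemma dprod_ext (x y : dprod) : (forall i, x i = y i) -> x = y.
Proof. exact: functional_extensionality_dep. Qed.
Lemma dprodD (x y : dprod) i : (x + y) i = x i + y i. Proof. by []. Qed.
Lemma dprodN (x : dprod) i : (- x) i = - x i. Proof. by []. Qed.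
Lemma dprodB (x y : dprod) i : (x - y) i = x i - y i. Proof. by []. Qed.
Lemma dprod0 i : (0 : dprod) i = 0. Proof. by []. Qed.

End DirectProduct.

Section Subgroup.
Variables (V : zmodType) (S : zmodClosed V).
Definition subgroup : Type := {x : V | x \in S}.
HB.instance Definition _ := SubChoice.on subgroup.
HB.instance Definition _ := [SubChoice_isSubZmodule of subgroup by <:].
End Subgroup.

(* The subquotient Z / (Z :&: B) of V. *)
Section Subquotient.
Variables (V : zmodType) (Z B : zmodClosed V).

Definition subquot_den : {pred subgroup Z} := fun x => val x \in B.

Lemma subquot_den_closed : zmod_closed subquot_den.
Proof.
split=> [|x y]; rewrite -!topredE /= /subquot_den ?raddf0 ?raddfB.
  exact: rpred0.
exact: rpredB.
Qed.
HB.instance Definition _ :=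
  GRing.isZmodClosed.Build (subgroup Z) subquot_den subquot_den_closed.

Definition subquot : zmodType := Quotient.quot subquot_den.

Definition sqclass (x : V) (Zx : x \in Z) : subquot :=
  \pi_(Quotient.quot subquot_den) (exist _ x Zx : subgroup Z).

Lemma sqclassP (u : subquot) : exists x (Zx : x \in Z), u = sqclass Zx.
Proof.
exists (val (repr u)), (valP (repr u)); rewrite /sqclass.
by rewrite -[LHS]reprK; congr (\pi); apply: val_inj.
Qed.

Lemma sqclass_eq x y (Zx : x \in Z) (Zy : y \in Z) :
  sqclass Zx = sqclass Zy <-> x - y \in B.
Proof.
rewrite /sqclass; split=> [/eqP|h].
  by rewrite -Quotient.idealrBE -topredE /= /subquot_den raddfB.
by apply/eqP; rewrite -Quotient.idealrBE -topredE /= /subquot_den raddfB.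
Qed.

Lemma sqclassB x y (Zx : x \in Z) (Zy : y \in Z) (Zxy : x - y \in Z) :
  sqclass Zxy = sqclass Zx - sqclass Zy.
Proof.
by rewrite /sqclass -raddfB; congr (\pi); apply: val_inj; rewrite raddfB.
Qed.

End Subquotient.

Section SubquotientMap.
Variables (V V' : zmodType) (Z B : zmodClosed V) (Z' B' : zmodClosed V').
Variable f : {additive V -> V'}.
Hypothesis fZ : forall x, x \in Z -> f x \in Z'.
Hypothesis fB : forall x, x \in Z -> x \in B -> f x \in B'.

Let subquot_fun (u : subquot Z B) : subquot Z' B' :=
  sqclass B' (fZ (valP (repr u))).

Let subquot_funE x (Zx : x \in Z) :
  subquot_fun (sqclass B Zx) = sqclass B' (fZ Zx).
Proof.
apply/sqclass_eq; rewrite -raddfB; apply: fB.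
  by apply: rpredB => //; exact: valP.
apply/(sqclass_eq _ (valP (repr (sqclass B Zx))) Zx).
rewrite -[RHS]reprK /sqclass; congr (\pi); exact: val_inj.
Qed.

Let subquot_fun_additive : zmod_morphism subquot_fun.
Proof.
move=> u v; have [x [Zx ->]] := sqclassP u; have [y [Zy ->]] := sqclassP v.
have Zxy : x - y \in Z by exact: rpredB.
have Zf : f x - f y \in Z' by rewrite -raddfB; exact: fZ.
rewrite -(sqclassB _ _ _ Zxy) !subquot_funE -(sqclassB _ _ _ Zf).
by apply/sqclass_eq; rewrite raddfB subrr rpred0.
Qed.

Definition subquot_map : {additive subquot Z B -> subquot Z' B'} :=
  HB.pack subquot_fun (GRing.isZmodMorphism.Build _ _ _ subquot_fun_additive).

Lemma subquot_mapE x (Zx : x \in Z) :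
  subquot_map (sqclass B Zx) = sqclass B' (fZ Zx).
Proof. exact: subquot_funE. Qed.

End SubquotientMap.

(* Z need not be contained in Z'; this determines f when every class in the
   source has a representative in Z'. *)
Definition induced_by_id (V : zmodType) (Z B Z' B' : zmodClosed V)
    (f : {additive subquot Z B -> subquot Z' B'}) : Prop :=
  forall x (Zx : x \in Z) (Z'x : x \in Z'), f (sqclass B Zx) = sqclass B' Z'x.

Definition short_exact (A B C : zmodType)
    (f : {additive A -> B}) (g : {additive B -> C}) : Prop :=
  [/\ injective f, (forall b, g b = 0 <-> exists a, f a = b)
    & forall c, exists b, g b = c].

(* For g the projection of a short exact sequence. *)
Definition splits (B C : zmodType) (g : {additive B -> C}) : Prop :=
  exists s : {additive C -> B}, cancel s g.

(* A Z[C_2]-module is an abelian group with the action of the generator. *)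
Record c2mod := C2Mod {
  c2_sort :> zmodType;
  c2_act : {additive c2_sort -> c2_sort};
  c2_actK : involutive c2_act }.
Arguments c2_act {_}.

Definition equivariant (M N : c2mod) (f : M -> N) : Prop :=
  forall x, f (c2_act x) = c2_act (f x).

(* The coefficient of e in Z[C_2] is a e + b e * g, g the generator. *)
Definition c2_comb (M : c2mod) (s : seq M) (a b : M -> int) : M :=
  \sum_(e <- s) (e *~ a e + c2_act e *~ b e).

Definition c2_basis (M : c2mod) (E : {pred M}) : Prop :=
  (forall x, exists s a b, {subset s <= E} /\ x = c2_comb s a b) /\
  (forall s a b, uniq s -> {subset s <= E} -> c2_comb s a b = 0 ->
     forall e, e \in s -> a e = 0 /\ b e = 0).

Definition c2_free (M : c2mod) : Prop := exists E : {pred M}, c2_basis E.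

(* A free resolution of Z with trivial action; the cellular chains of a
   contractible free C_2-CW-complex are one, with the basis given by a choice
   of a cell in each orbit. *)
Record free_resolution := FreeResolution {
  res_obj :> nat -> c2mod;
  res_diff : forall i, {additive res_obj i.+1 -> res_obj i};
  res_aug : {additive res_obj 0 -> int};
  res_free : forall i, c2_free (res_obj i);
  res_diff_equiv : forall i, equivariant (res_diff i);
  res_aug_equiv : forall x, res_aug (c2_act x) = res_aug x;
  res_exact : forall i x,
    res_diff i x = 0 <-> exists y, res_diff i.+1 y = x;
  res_exact0 : forall x, res_aug x = 0 <-> exists y, res_diff 0 y = x;
  res_aug_surj : forall m, exists x, res_aug x = m }.

(* Cohomological grading by all integers.  A differential is given as a map
   X^j -> X^j' for all j and j', zero unless j' = j + 1; this avoids transport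
   between equal but not convertible degrees. *)
Record c2complex := C2Complex {
  cx_obj :> int -> c2mod;
  cx_diff : forall j j', {additive cx_obj j -> cx_obj j'};
  cx_diff_shape : forall j j' x, j' != j + 1 -> cx_diff j j' x = 0;
  cx_diff_equiv : forall j j', equivariant (cx_diff j j');
  cx_diffK : forall j j' j'' x, cx_diff j' j'' (cx_diff j j' x) = 0 }.

Section HomC2.
Variables M N : c2mod.

Definition hom_pred : {pred M -> N} :=
  fun f => `[< zmod_morphism f /\ equivariant f >].

Lemma hom_predP (f : M -> N) :
  reflect (zmod_morphism f /\ equivariant f) (f \in hom_pred).
Proof. exact: asboolP. Qed.

Lemma hom_pred_closed : zmod_closed hom_pred.
Proof.
split=> [|f g /hom_predP[fB fe] /hom_predP[gB ge]]; apply/hom_predP; split.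
- by move=> x y; rewrite subr0.
- by move=> x; rewrite raddf0.
- move=> x y; change (f (x - y) - g (x - y) = f x - g x - (f y - g y)).
  by rewrite fB gB !opprD !opprK addrACA.
- move=> x; change (f (c2_act x) - g (c2_act x) = c2_act (f x - g x)).
  by rewrite raddfB fe ge.
Qed.
HB.instance Definition _ :=
  GRing.isZmodClosed.Build (M -> N) hom_pred hom_pred_closed.

Definition homC2 : zmodType := subgroup hom_pred.

Implicit Types f g : homC2.

Lemma homC2_0 x : val (0 : homC2) x = 0.
Proof. by rewrite raddf0. Qed.

Lemma homC2B f g x : val (f - g) x = val f x - val g x.
Proof. by rewrite raddfB. Qed.

Lemma homC2_ext f g : (forall x, val f x = val g x) -> f = g.
Proof. by move=> fg; apply: val_inj; exact: funext. Qed.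

End HomC2.

Lemma equivariant_id (M : c2mod) : equivariant (@idfun M).
Proof. by []. Qed.

Section HomMap.
Variables M M' N N' : c2mod.
Variables (a : {additive M' -> M}) (b : {additive N -> N'}).
Hypotheses (ea : equivariant a) (eb : equivariant b).

Let hom_map_subproof (f : homC2 M N) :
  b \o val f \o a \in @hom_pred M' N'.
Proof.
have /hom_predP[fB fe] := valP f; apply/hom_predP; split=> [x y|x] /=.
  by rewrite raddfB fB raddfB.
by rewrite ea fe eb.
Qed.

Let hom_map_fun (f : homC2 M N) : homC2 M' N' :=
  exist _ (b \o val f \o a) (hom_map_subproof f).

Let hom_map_additive : zmod_morphism hom_map_fun.
Proof.
move=> f g; apply: homC2_ext => x; rewrite homC2B /=.
by apply: (eq_trans (congr1 b (homC2B f g (a x)))); exact: raddfB.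
Qed.

Definition hom_map : {additive homC2 M N -> homC2 M' N'} :=
  HB.pack hom_map_fun (GRing.isZmodMorphism.Build _ _ _ hom_map_additive).

Lemma hom_mapE f x : val (hom_map f) x = b (val f (a x)).
Proof. by []. Qed.

End HomMap.

(* First degree in the natural numbers; the convention for the second
   differential is the one of c2complex.  The squares commute, so that the sign
   appears in the total differential. *)
Record double_complex := DoubleComplex {
  dc_obj :> nat -> int -> zmodType;
  dc_h : forall i j, {additive dc_obj i j -> dc_obj i.+1 j};
  dc_v : forall i j j', {additive dc_obj i j -> dc_obj i j'};
  dc_v_shape : forall i j j' x, j' != j + 1 -> dc_v i j j' x = 0;
  dc_hK : forall i j x, dc_h i.+1 j (dc_h i j x) = 0;
  dc_vK : forall i j j' j'' x, dc_v i j' j'' (dc_v i j j' x) = 0;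
  dc_comm : forall i j j' x,
    dc_h i j' (dc_v i j j' x) = dc_v i.+1 j j' (dc_h i j x) }.
Arguments dc_h {_}.
Arguments dc_v {_}.

Section SpectralSequence.
Variable A : double_complex.

Implicit Types (p r : nat) (q m : int).

(* The product of all A i j; its elements of degree m (see tot_fil below) form
   the total complex in degree m.  For each m this is the direct sum as well
   when A i j = 0 for all but finitely many j. *)
Definition tot : zmodType := dprod (fun i => dprod (fun j => A i j)).

(* d + (-1)^i d' *)
Definition tot_diff_fun (x : tot) : tot := fun i j =>
  (if i is i'.+1 return A i j then dc_h i' j (x i' j) else 0)
  + dc_v i (j - 1) j (x i (j - 1)) *~ (-1) ^+ i.

Lemma tot_diff_additive : zmod_morphism tot_diff_fun.
Proof.
move=> x y; apply: dprod_ext => i; apply: dprod_ext => j.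
rewrite !dprodB /tot_diff_fun.
have -> : (x - y) i (j - 1) = x i (j - 1) - y i (j - 1) by [].
rewrite raddfB mulrzBl; case: i => [|i]; first by rewrite !add0r.
by rewrite [X in dc_h i j X]/(_ - _) raddfB !opprD addrACA.
Qed.

Definition tot_diff : {additive tot -> tot} :=
  HB.pack tot_diff_fun (GRing.isZmodMorphism.Build _ _ _ tot_diff_additive).

Lemma tot_diffK x : tot_diff (tot_diff x) = 0.
Proof.
apply: dprod_ext => i; apply: dprod_ext => j; rewrite !dprod0.
change (tot_diff_fun (tot_diff_fun x) i j = 0); rewrite /tot_diff_fun.
rewrite raddfD raddfMz dc_vK mul0rz addr0.
case: i => [|i]; first by rewrite add0r raddf0 mul0rz.
rewrite raddfD raddfMz -dc_comm exprS mulN1r mulrNz -addrA subrr addr0.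
by case: i => [|i]; [rewrite raddf0|rewrite dc_hK].
Qed.

(* F^p Tot^m: elements of total degree m supported in first degrees >= p *)
Definition tot_fil p m (x : tot) : Prop :=
  forall i j, (i < p)%N || (i%:Z + j != m) -> x i j = 0.

Lemma tot_fil0 p m : tot_fil p m 0.
Proof. by []. Qed.

Lemma tot_filB p m x y : tot_fil p m x -> tot_fil p m y -> tot_fil p m (x - y).
Proof.
by move=> Fx Fy i j h; rewrite !dprodB Fx ?Fy ?subr0.
Qed.

Lemma tot_filS p p' m x : (p' <= p)%N -> tot_fil p m x -> tot_fil p' m x.
Proof.
move=> le_p Fx i j /orP[ip|im]; apply: Fx; last by rewrite im orbT.
by rewrite (leq_trans ip le_p).
Qed.

(* The spectral sequence of the filtration of Tot by the first degree, so that
   d_0 is +-d' and d_1 is induced by d: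
   E_r^{p,q} = Z_r^{p,q} / (Z_{r-1}^{p+1,q-1} + D Z_{r-1}^{p-r+1,q+r-2}) with
   Z_r^{p,q} = {x \in F^p Tot^{p+q} | D x \in F^{p+r}}.  For p - r + 1 < 0 the
   truncated subtraction is correct since F^0 = Tot.  For r = 0 the denominator
   is F^{p+1}. *)
Definition page_num r p q : {pred tot} :=
  fun x => `[< tot_fil p (p%:Z + q) x /\
               tot_fil (p + r) (p%:Z + q + 1) (tot_diff x) >].

Definition page_den r p q : {pred tot} :=
  fun x => `[< exists y z : tot,
    [/\ tot_fil p.+1 (p%:Z + q) y,
        tot_fil (p + r) (p%:Z + q + 1) (tot_diff y),
        tot_fil (p.+1 - r) (p%:Z + q - 1) z,
        tot_fil p (p%:Z + q) (tot_diff z)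
      & x = y + tot_diff z] >].

Lemma page_numP r p q x :
  reflect (tot_fil p (p%:Z + q) x /\
           tot_fil (p + r) (p%:Z + q + 1) (tot_diff x)) (x \in page_num r p q).
Proof. exact: asboolP. Qed.

Lemma page_denP r p q x :
  reflect (exists y z : tot,
    [/\ tot_fil p.+1 (p%:Z + q) y,
        tot_fil (p + r) (p%:Z + q + 1) (tot_diff y),
        tot_fil (p.+1 - r) (p%:Z + q - 1) z,
        tot_fil p (p%:Z + q) (tot_diff z)
      & x = y + tot_diff z]) (x \in page_den r p q).
Proof. exact: asboolP. Qed.

Lemma page_num_closed r p q : zmod_closed (page_num r p q).
Proof.
split=> [|x y /page_numP[Fx Dx] /page_numP[Fy Dy]]; apply/page_numP.
  by rewrite raddf0.
by rewrite raddfB; split; exact: tot_filB.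
Qed.
HB.instance Definition _ r p q :=
  GRing.isZmodClosed.Build tot (page_num r p q) (page_num_closed r p q).

Lemma page_den_closed r p q : zmod_closed (page_den r p q).
Proof.
split=> [|_ _ /page_denP[y [z [Fy Dy Fz Dz ->]]]
          /page_denP[y' [z' [Fy' Dy' Fz' Dz' ->]]]]; apply/page_denP.
  by exists 0, 0; rewrite !raddf0 addr0.
exists (y - y'), (z - z'); rewrite !raddfB.
split; [exact: tot_filB | exact: tot_filB | exact: tot_filB
  | exact: tot_filB | by rewrite opprD addrACA].
Qed.
HB.instance Definition _ r p q :=
  GRing.isZmodClosed.Build tot (page_den r p q) (page_den_closed r p q).

Definition page r p q : zmodType := subquot (page_num r p q) (page_den r p q).

Lemma page_degE r p q : (p + r)%N%:Z + (q - r%:Z + 1) = p%:Z + q + 1.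
Proof. by rewrite PoszD addrA; congr (_ + 1); rewrite addrACA subrr addr0. Qed.

Lemma tot_diff_num r p q x :
  x \in page_num r p q -> tot_diff x \in page_num r (p + r) (q - r%:Z + 1).
Proof.
case/page_numP=> Fx Dx; apply/page_numP.
by rewrite page_degE tot_diffK; split.
Qed.

Lemma tot_diff_den r p q x : x \in page_num r p q -> x \in page_den r p q ->
  tot_diff x \in page_den r (p + r) (q - r%:Z + 1).
Proof.
move=> _ /page_denP[y [z [Fy Dy Fz Dz ->]]]; apply/page_denP.
exists 0, y; rewrite page_degE addrK -addSn addnK raddf0 add0r.
by split=> //; rewrite raddfD tot_diffK addr0.
Qed.

Definition page_diff r p q :
    {additive page r p q -> page r (p + r) (q - r%:Z + 1)} :=
  subquot_map (@tot_diff_num r p q) (@tot_diff_den r p q).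

Definition collapses_at r : Prop :=
  forall s, (r <= s)%N -> forall p q (u : page s p q), page_diff s p q u = 0.

Definition cocycles p m : {pred tot} :=
  fun x => `[< tot_fil p m x /\ tot_diff x = 0 >].

Definition coboundaries m : {pred tot} :=
  fun x => `[< exists2 z, tot_fil 0 (m - 1) z & x = tot_diff z >].

Lemma cocyclesP p m x :
  reflect (tot_fil p m x /\ tot_diff x = 0) (x \in cocycles p m).
Proof. exact: asboolP. Qed.

Lemma coboundariesP m x :
  reflect (exists2 z, tot_fil 0 (m - 1) z & x = tot_diff z)
          (x \in coboundaries m).
Proof. exact: asboolP. Qed.

Lemma cocycles_closed p m : zmod_closed (cocycles p m).
Proof.
split=> [|x y /cocyclesP[Fx Dx] /cocyclesP[Fy Dy]]; apply/cocyclesP.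
  by rewrite raddf0.
by rewrite raddfB Dx Dy subr0; split=> //; exact: tot_filB.
Qed.
HB.instance Definition _ p m :=
  GRing.isZmodClosed.Build tot (cocycles p m) (cocycles_closed p m).

Lemma coboundaries_closed m : zmod_closed (coboundaries m).
Proof.
split=> [|_ _ /coboundariesP[y Fy ->] /coboundariesP[z Fz ->]];
  apply/coboundariesP; first by exists 0; rewrite ?raddf0.
by exists (y - z); [exact: tot_filB|rewrite raddfB].
Qed.
HB.instance Definition _ m :=
  GRing.isZmodClosed.Build tot (coboundaries m) (coboundaries_closed m).

(* F^p H^m(Tot), the image of H^m(F^p Tot); tot_coh 0 m is H^m(Tot). *)
Definition tot_coh p m : zmodType := subquot (cocycles p m) (coboundaries m).

Lemma cocyclesS p m x : x \in cocycles p.+1 m -> x \in cocycles p m.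
Proof.
case/cocyclesP=> Fx Dx; apply/cocyclesP; split=> //.
exact: tot_filS (leqnSn p) Fx.
Qed.

Definition tot_coh_incl p m : {additive tot_coh p.+1 m -> tot_coh p m} :=
  subquot_map (f := idfun) (@cocyclesS p m) (fun _ _ => id).

Lemma cocycles_num r p q x :
  x \in cocycles p (p%:Z + q) -> x \in page_num r p q.
Proof. by case/cocyclesP=> Fx Dx; apply/page_numP; rewrite Dx. Qed.

(* g is the projection of the extension
     0 -> F^{p+1} H^{p+q} -> F^p H^{p+q} -> E_r^{p,q} -> 0
   available when E_r = E_oo. *)
Definition filtration_ext r p q
    (g : {additive tot_coh p (p%:Z + q) -> page r p q}) : Prop :=
  induced_by_id g /\ short_exact (tot_coh_incl p (p%:Z + q)) g.

Definition trivial_ext r p q : Prop :=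
  exists g : {additive tot_coh p (p%:Z + q) -> page r p q},
    filtration_ext g /\ splits g.

End SpectralSequence.

Section HomDoubleComplex.
Variables (W : free_resolution) (D : c2complex).

Definition hdc_obj (i : nat) (j : int) : zmodType := homC2 (W i) (D j).

Definition hdc_h i j : {additive hdc_obj i j -> hdc_obj i.+1 j} :=
  hom_map (@res_diff_equiv W i) (@equivariant_id (D j)).

Definition hdc_v i j j' : {additive hdc_obj i j -> hdc_obj i j'} :=
  hom_map (@equivariant_id (W i)) (@cx_diff_equiv D j j').

Lemma hdc_v_shape i j j' x : j' != j + 1 -> hdc_v i j j' x = 0.
Proof.
move=> jj'; apply: homC2_ext => w; rewrite homC2_0; exact: cx_diff_shape.
Qed.

Lemma hdc_hK i j x : hdc_h i.+1 j (hdc_h i j x) = 0.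
Proof.
apply: homC2_ext => w; rewrite homC2_0 /=.
have -> : res_diff W i (res_diff W i.+1 w) = 0 by apply/res_exact; exists w.
have /hom_predP[xB _] := valP x.
by rewrite -(subrr 0) xB subrr.
Qed.

Lemma hdc_vK i j j' j'' x : hdc_v i j' j'' (hdc_v i j j' x) = 0.
Proof. by apply: homC2_ext => w; rewrite homC2_0; exact: cx_diffK. Qed.

Lemma hdc_comm i j j' x :
  hdc_h i j' (hdc_v i j j' x) = hdc_v i.+1 j j' (hdc_h i j x).
Proof. exact: homC2_ext. Qed.

Definition hom_double_complex : double_complex :=
  DoubleComplex hdc_v_shape hdc_hK hdc_vK hdc_comm.

End HomDoubleComplex.

Section TensorSquare.
Variables (n : nat) (k : int).

Implicit Types a b j : int.

(* C(n,k)^a = Z^(C_rank a), as row vectors, with differential the right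
   multiplication by C_diff a (a + 1). *)
Definition C_rank a : nat := (a == k - 1) || (a == k).

Definition C_diff a b : 'M[int]_(C_rank a, C_rank b) :=
  const_mx (if (a == k - 1) && (b == k) then n%:Z else 0).

Lemma C_diffK a b c : C_diff a b *m C_diff b c = 0.
Proof.
apply/matrixP => s t; rewrite !mxE big1 // => u _; rewrite !mxE.
have [/andP[_ /eqP->]|_] := ifP; last by rewrite mul0r.
by rewrite -subr_eq0 opprD addrA subrr opprK add0r oner_eq0 /= mulr0.
Qed.

(* Z^s (x) Z^t is 'M[int]_(s, t), with c (x) c' = c^T *m c'.  The component of
   degree (a, b) of x in the tensor square is x a b. *)
Definition tens : zmodType :=
  dprod (fun a => dprod (fun b => 'M[int]_(C_rank a, C_rank b))).

(* The direct sum of the components of degree (a, b) with a + b = j; only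
   finitely many of them are nonzero. *)
Definition tens_deg j : {pred tens} :=
  fun x => `[< forall a b, a + b != j -> x a b = 0 >].

Lemma tens_degP j (x : tens) :
  reflect (forall a b, a + b != j -> x a b = 0) (x \in tens_deg j).
Proof. exact: asboolP. Qed.

Lemma tens_deg_closed j : zmod_closed (tens_deg j).
Proof.
split=> [|x y /tens_degP hx /tens_degP hy]; apply/tens_degP => a b h //.
by rewrite !dprodB hx ?hy ?subr0.
Qed.
HB.instance Definition _ j :=
  GRing.isZmodClosed.Build tens (tens_deg j) (tens_deg_closed j).

(* c (x) c' |-> (-1)^(deg c deg c') c' (x) c *)
Definition tens_swap_fun (x : tens) : tens :=
  fun a b => (-1) ^ (a * b) *: (x b a)^T.

Lemma tens_swap_additive : zmod_morphism tens_swap_fun.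
Proof.
move=> x y; apply: dprod_ext => a; apply: dprod_ext => b.
rewrite !dprodB /tens_swap_fun.
have -> : (x - y) b a = x b a - y b a by [].
by rewrite linearB scalerBr.
Qed.

Definition tens_swap : {additive tens -> tens} :=
  HB.pack tens_swap_fun (GRing.isZmodMorphism.Build _ _ _ tens_swap_additive).

Lemma tens_swapE x a b : tens_swap x a b = (-1) ^ (a * b) *: (x b a)^T.
Proof. by []. Qed.

(* c (x) c' |-> d c (x) c' + (-1)^(deg c) c (x) d c' *)
Definition tens_diff_fun (x : tens) : tens := fun a b =>
  (C_diff (a - 1) a)^T *m x (a - 1) b
  + (-1) ^ a *: (x a (b - 1) *m C_diff (b - 1) b).

Lemma tens_diff_additive : zmod_morphism tens_diff_fun.
Proof.
move=> x y; apply: dprod_ext => a; apply: dprod_ext => b.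
rewrite !dprodB /tens_diff_fun.
have E c d : (x - y) c d = x c d - y c d by [].
by rewrite !E mulmxBr mulmxBl scalerBr opprD addrACA.
Qed.

Definition tens_diff : {additive tens -> tens} :=
  HB.pack tens_diff_fun (GRing.isZmodMorphism.Build _ _ _ tens_diff_additive).

Lemma tens_diffE x a b : tens_diff x a b =
  (C_diff (a - 1) a)^T *m x (a - 1) b
  + (-1) ^ a *: (x a (b - 1) *m C_diff (b - 1) b).
Proof. by []. Qed.

Lemma signzD a b : (-1 : int) ^ (a + b) = (-1) ^ a * (-1) ^ b.
Proof. by rewrite exprzDr // unitrN1. Qed.

Lemma signzM a : (-1 : int) ^ a * (-1) ^ a = 1.
Proof. by rewrite -exprzMl ?unitrN1 // mulrNN mulr1 exp1rz. Qed.

Lemma signzB a b : (-1 : int) ^ (a - b) = (-1) ^ a * (-1) ^ b.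
Proof. by rewrite -{2}(subrK b a) [in RHS]signzD -mulrA signzM mulr1. Qed.

Lemma signzB1 a : (-1 : int) ^ (a - 1) = - (-1) ^ a.
Proof. by rewrite signzB mulrN1. Qed.

Lemma tens_swapK : involutive tens_swap.
Proof.
move=> x; apply: dprod_ext => a; apply: dprod_ext => b.
by rewrite !tens_swapE linearZ /= trmxK scalerA [b * a]mulrC signzM scale1r.
Qed.

Lemma tens_diffK x : tens_diff (tens_diff x) = 0.
Proof.
apply: dprod_ext => a; apply: dprod_ext => b; rewrite !dprod0 !tens_diffE.
rewrite mulmxDr mulmxDl mulmxA -trmx_mul.
rewrite (C_diffK (a - 1 - 1) (a - 1) a) trmx0 mul0mx add0r.
rewrite scalerDr -!scalemxAl -(mulmxA (x a _)) (C_diffK (b - 1 - 1) (b - 1) b) mulmx0 !scaler0 addr0.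
by rewrite -scalemxAr mulmxA signzB1 scaleNr addNr.
Qed.

Lemma tens_swap_diff x : tens_swap (tens_diff x) = tens_diff (tens_swap x).
Proof.
apply: dprod_ext => a; apply: dprod_ext => b.
rewrite tens_swapE !tens_diffE !tens_swapE !(linearD, linearZ) /=.
rewrite !trmx_mul trmxK -!scalemxAl !scalerA addrC.
congr (_ *: _ + _ *: _).
  by rewrite mulrBl mul1r signzB mulrC.
by rewrite mulrBr mulr1 signzB mulrCA signzM mulr1.
Qed.

Lemma tens_swap_deg j x : x \in tens_deg j -> tens_swap x \in tens_deg j.
Proof.
move=> /tens_degP hx; apply/tens_degP => a b h.
by rewrite tens_swapE hx ?trmx0 ?scaler0 1?addrC.
Qed.

Definition D_swap_fun j (x : subgroup (tens_deg j)) : subgroup (tens_deg j) :=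
  exist _ (tens_swap (val x)) (tens_swap_deg (valP x)).

Lemma D_swap_additive j : zmod_morphism (@D_swap_fun j).
Proof.
move=> x y; apply: val_inj; rewrite [RHS]raddfB.
exact: (raddfB tens_swap (val x) (val y)).
Qed.

Definition D_swap j :
    {additive subgroup (tens_deg j) -> subgroup (tens_deg j)} :=
  HB.pack (@D_swap_fun j) (GRing.isZmodMorphism.Build _ _ _ (@D_swap_additive j)).

Lemma D_swapK j : involutive (D_swap j).
Proof. by move=> x; apply: val_inj; exact: tens_swapK. Qed.

Definition D_obj j : c2mod := C2Mod (@D_swapK j).

(* tens_diff if j' = j + 1, zero otherwise *)
Lemma tens_diff_deg j j' x : x \in tens_deg j ->
  tens_diff x *+ (j' == j + 1) \in tens_deg j'.
Proof.
have [->|_] := eqVneq j'; last by rewrite mulr0n rpred0.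
move=> /tens_degP hx; apply/tens_degP => a b h; rewrite mulr1n tens_diffE.
rewrite !hx ?mulmx0 ?mul0mx ?scaler0 ?addr0 //.
  by apply: contra h => /eqP <-; rewrite -addrA subrK.
by apply: contra h => /eqP <-; rewrite addrAC subrK.
Qed.

Definition D_diff_fun j j' (x : D_obj j) : D_obj j' :=
  exist _ (tens_diff (val x) *+ (j' == j + 1)) (tens_diff_deg j' (valP x)).

Lemma D_diff_additive j j' : zmod_morphism (@D_diff_fun j j').
Proof.
move=> x y; apply: val_inj; rewrite [RHS]raddfB -mulrnBl.
by congr (_ *+ _); exact: (raddfB tens_diff (val x) (val y)).
Qed.

Definition D_diff j j' : {additive D_obj j -> D_obj j'} :=
  HB.pack (@D_diff_fun j j')
    (GRing.isZmodMorphism.Build _ _ _ (@D_diff_additive j j')).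

Lemma D_diff_shape j j' x : j' != j + 1 -> D_diff j j' x = 0.
Proof. by move=> /negbTE h; apply: val_inj; rewrite raddf0 /= h. Qed.

Lemma D_diff_equiv j j' : equivariant (D_diff j j').
Proof.
move=> x; apply: val_inj.
change (tens_diff (tens_swap (val x)) *+ (j' == j + 1) =
        tens_swap (tens_diff (val x) *+ (j' == j + 1))).
by rewrite -tens_swap_diff raddfMn.
Qed.

Lemma D_diffK j j' j'' x : D_diff j' j'' (D_diff j j' x) = 0.
Proof.
apply: val_inj; rewrite raddf0.
change (tens_diff (tens_diff (val x) *+ (j' == j + 1)) *+ (j'' == j' + 1) = 0).
by rewrite raddfMn tens_diffK !mul0rn.
Qed.

Definition D_complex : c2complex :=
  C2Complex D_diff_shape D_diff_equiv D_diffK.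

End TensorSquare.

(* Main.v *)
Require Import Defs.
From HB Require Import structures.
From mathcomp Require Import all_boot all_order all_algebra.
From mathcomp Require Import ring_quotient boolp.
From mathcomp Require Import zify ring.

Set Implicit Arguments.
Unset Strict Implicit.
Unset Printing Implicit Defensive.

Import Order.TTheory GRing.Theory Num.Theory.

Local Open Scope ring_scope.

(** Two maps of free resolutions over the identity of Z are chain homotopic, and
    the homotopy lowers the filtration of the total complex by one. Such a
    homotopy is invisible on the pages from 2 on and in the cohomology of Tot
    (filtered_equiv_page, filtered_equiv_coh). So W may be replaced by the
    standard resolution, which is free of rank one in each degree
    (resolution_invariance).

    There the total complex becomes explicit. Let x and y be the generators of
    C(n,k) in the degrees k - 1 and k. An element of degree m is a quadruple
    (a, b, c, e) of integers, the coefficients of y (x) y, x (x) y, y (x) x and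
    x (x) x, placed in the first degrees N, N + 1, N + 1 and N + 2, where
    N = m - 2 k; a coefficient with a negative first degree is absent. The
    boundary of the quadruple depends only on n and the signs (-1)^k and (-1)^N
    (tot_diff_elt). The groups of the pages are thus subquotients of Z^4 cut out
    by linear conditions. Only the rows 2 k - 1 and 2 k contribute, and the
    answer at the column p depends on the parity of p + k:
    - if p + k is even, then y (x) y is a cocycle and generates the row 2 k, with
      the order n for p = 0 and gcd(2, n) for p > 0; the row 2 k - 1 is a group
      of order gcd(2, n), and nothing changes on the page 3;
    - if p + k is odd, then on the page 2 the row 2 k - 1 is generated by
      x (x) y - (-1)^k y (x) x, with the order n for p = 0 and gcd(2, n) for
      p > 0. The row 2 k has the order gcd(2, n), with the generator
      (n / 2) y (x) y - x (x) y for n even; its boundary is, up to sign, the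
      generator of the row 2 k - 1 in the column p + 2. So d_2 is an isomorphism
      between these groups; on the page 3 the row 2 k disappears, and the row
      2 k - 1 survives only for p = 0 and p = 1.

    With two rows no differential d_s with s > 2 has room, so that the spectral
    sequences collapse at 3, and at 2 if n is odd; a bounded collapsing spectral
    sequence converges (collapse_filtration_ext). On the last page each total
    degree contains at most one nonzero group, whence all extensions are trivial
    (D_trivial_ext), except in the degree 0 for k = 0 and n even. There Z/n at
    (0, 0) is extended by Z/2 at (1, -1). Both groups are killed by n, but the
    class of y (x) y in the cohomology of Tot is not (tot_coh_not_killed), and so
    the extension does not split. *)

(** * Groups up to isomorphism, and subquotients *)

Lemma isog_inj_surj (A B : zmodType) (f : {additive A -> B}) :
  injective f -> (forall b, exists a, f a = b) -> isog A B.
Proof.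
move=> fI fS; exists f; exists (fun b => projT1 (cid (fS b))) => [a|b].
  by apply: fI; case: cid.
by case: cid.
Qed.

Lemma isog_inv (A B : zmodType) (f : {additive A -> B}) :
  bijective f -> exists g : {additive B -> A}, cancel f g /\ cancel g f.
Proof.
case=> g fK gK; have gB := can2_zmod_morphism fK gK.
pose ga : {additive B -> A} := HB.pack g (GRing.isZmodMorphism.Build _ _ _ gB).
by exists ga.
Qed.

Lemma isog_sym (A B : zmodType) : isog A B -> isog B A.
Proof. by case=> f /isog_inv[g [fK gK]]; exists g; exists f. Qed.

Lemma isog_trans (A B C : zmodType) : isog A B -> isog B C -> isog A C.
Proof.
move=> [f bf] [g bg]; exists (g \o f : {additive A -> C}).
exact: bij_comp.
Qed.

Lemma isog_mulrn_eq0 (A B : zmodType) (o : nat) :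
  isog A B -> (forall b : B, b *+ o = 0) -> forall a : A, a *+ o = 0.
Proof.
move=> [f /bij_inj fI] Bo a; apply: fI.
by rewrite raddfMn Bo raddf0.
Qed.

Lemma Zmod_mulrn (o : nat) (z : Zmod o) : (0 < o)%N -> z *+ o = 0.
Proof.
case: o z => // o z _; apply: val_inj => /=.
by rewrite Zp_mulrn /= modnMl.
Qed.

Lemma isog_Zmod_mulrn (A : zmodType) (o : nat) :
  (0 < o)%N -> isog A (Zmod o) -> forall a : A, a *+ o = 0.
Proof. by move=> o0 /isog_mulrn_eq0; apply=> z; exact: Zmod_mulrn. Qed.

Lemma isog_Zmod1 (A : zmodType) : isog A (Zmod 1) -> forall a : A, a = 0.
Proof. by move=> /isog_Zmod_mulrn A1 a; rewrite -[a]mulr1n A1. Qed.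

Lemma isog_cyclic (A : zmodType) (o : nat) (x : A) : (0 < o)%N ->
  (forall a : A, exists c : int, a = x *~ c) ->
  (forall c : int, x *~ c = 0 <-> (o %| c)%Z) ->
  isog A (Zmod o).
Proof.
case: o => // o _ xgen xord; apply: isog_sym.
have xo : x *+ o.+1 = 0.
  by have [_] := xord o.+1%:Z; rewrite dvdzz -pmulrn; apply.
pose f (k : Zmod o.+1) : A := x *+ k.
have fB : zmod_morphism f.
  have xmod m : x *+ (m %% o.+1) = x *+ m.
    by rewrite [in RHS](divn_eq m o.+1) mulrnDr mulnC mulrnA xo mul0rn add0r.
  move=> k l; rewrite /f -[LHS]/(x *+ ((k + (o.+1 - l) %% o.+1) %% o.+1)%N).
  rewrite modnDmr xmod mulrnDr.
  by rewrite mulrnBr ?xo ?sub0r // ltnW.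
pose fa : {additive Zmod o.+1 -> A} :=
  HB.pack f (GRing.isZmodMorphism.Build _ _ _ fB).
apply: (@isog_inj_surj _ _ fa).
  apply: raddf_inj => k fk; apply: val_inj => /=.
  have /(xord k%:Z) : x *~ k%:Z = 0 by rewrite -pmulrn.
  rewrite dvdzE => /dvdnP[[|q]] //= kq; have := ltn_ord k.
  by rewrite [X in (X < _)%N]kq; lia.
move=> a; have [c ->] := xgen a.
have lt_co : (`|(c %% o.+1)%Z|%N < o.+1)%N by have := @ltz_pmod c o.+1 isT; lia.
exists (Ordinal lt_co); rewrite /= /f /=.
have -> : x *+ `|(c %% o.+1)%Z|%N = x *~ (c %% o.+1)%Z.
  by rewrite pmulrn; congr (_ *~ _); have := @modz_ge0 c o.+1 isT; lia.
rewrite [in RHS](divz_eq c o.+1) [RHS]mulrzDr mulrzA mulrzAC -pmulrn.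
by rewrite xo mul0rz add0r.
Qed.

Lemma sqclass_eq0 (V : zmodType) (Z B : zmodClosed V) x (Zx : x \in Z) :
  sqclass B Zx = 0 <-> x \in B.
Proof.
have <- : sqclass B (rpred0 Z) = 0.
  pose pi : {additive subgroup Z -> subquot Z B} :=
    \pi_(Quotient.quot (@subquot_den V Z B))%qT.
  rewrite -[LHS]/(pi (exist _ 0 (rpred0 Z) : subgroup Z)) -[RHS](raddf0 pi).
  by congr (pi _); apply: val_inj; rewrite raddf0.
by rewrite sqclass_eq subr0.
Qed.

Lemma sqclassMz (V : zmodType) (Z B : zmodClosed V) x (Zx : x \in Z) (c : int)
    (Zxc : x *~ c \in Z) :
  sqclass B Zxc = sqclass B Zx *~ c.
Proof.
pose pi : {additive subgroup Z -> subquot Z B} :=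
  \pi_(Quotient.quot (@subquot_den V Z B))%qT.
pose sub y (Zy : y \in Z) : subgroup Z := exist (fun y => y \in Z) y Zy.
rewrite -[LHS]/(pi (sub _ Zxc)) -[sqclass B Zx]/(pi (sub _ Zx)) -raddfMz.
by congr (pi _); apply: val_inj; rewrite raddfMz.
Qed.

Lemma isog_subquot_cyclic (V : zmodType) (Z B : zmodClosed V) (o : nat) (x : V) :
  (0 < o)%N -> x \in Z ->
  (forall u, u \in Z -> exists c : int, u - x *~ c \in B) ->
  (forall c : int, x *~ c \in B <-> (o %| c)%Z) ->
  isog (subquot Z B) (Zmod o).
Proof.
move=> o0 Zx xgen xord.
have Zxc c : x *~ c \in Z by exact: rpredMz.
apply: (@isog_cyclic _ _ (sqclass B Zx)) => // [a|c].
  have [u [Zu ->]] := sqclassP a; have [c Buc] := xgen u Zu.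
  by exists c; rewrite -(sqclassMz B Zx (Zxc c)); apply/sqclass_eq.
by rewrite -(sqclassMz B Zx (Zxc c)) sqclass_eq0.
Qed.

Lemma isog_subquot (V V' : zmodType) (Z B : zmodClosed V)
    (Z' B' : zmodClosed V') (f : {additive V -> V'}) (g : {additive V' -> V}) :
  (forall x, x \in Z -> f x \in Z') ->
  (forall x, x \in Z -> x \in B -> f x \in B') ->
  (forall x, x \in Z' -> g x \in Z) ->
  (forall x, x \in Z' -> x \in B' -> g x \in B) ->
  (forall x, x \in Z -> g (f x) - x \in B) ->
  (forall x, x \in Z' -> f (g x) - x \in B') ->
  isog (subquot Z B) (subquot Z' B').
Proof.
move=> fZ fB gZ gB gf fg.
exists (subquot_map fZ fB); exists (subquot_map gZ gB) => u.
  by have [x [Zx ->]] := sqclassP u; rewrite !subquot_mapE; apply/sqclass_eq/gf.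
by have [x [Zx ->]] := sqclassP u; rewrite !subquot_mapE; apply/sqclass_eq/fg.
Qed.

(** * Convergence of a collapsing spectral sequence *)

Lemma tot_coh_inclE (A : double_complex) p m x (Zx : x \in cocycles p.+1 m) :
  tot_coh_incl A p m (sqclass _ Zx) = sqclass _ (cocyclesS Zx).
Proof. exact: subquot_mapE. Qed.

Section Convergence.
Variables (A : double_complex) (r : nat).

Implicit Types (p q : nat) (m : int).

(** Satisfied when the rows are bounded below: an element of large first degree
    has then a second degree where all groups vanish. *)
Definition fil_bounded : Prop :=
  forall m, exists P, forall x : tot A, tot_fil P m x -> x = 0.

Hypothesis A_bounded : fil_bounded.

(** If d_s vanishes on the class of x, then the boundary of x is, up to an
    element of F^{p+s+1}, the boundary of an element of F^{p+1}; subtracting the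
    latter from x pushes the boundary of x one step down the filtration. In a
    bounded filtration the boundary becomes zero after finitely many steps. *)
Lemma page_num_cocycle p (q : int) (x : tot A) :
  collapses_at A r -> x \in page_num r p q ->
  exists2 x', x' \in cocycles p (p%:Z + q) & x - x' \in page_den r p q.
Proof.
move=> Ar Zx.
have lift t : exists2 x', x' \in page_num (r + t) p q
                        & x - x' \in page_den r p q.
  elim: t => [|t [x' Zx' Bxx']].
    by exists x; rewrite ?addn0 // subrr rpred0.
  have := Ar (r + t)%N (leq_addr t r) p q (sqclass _ Zx').
  rewrite /page_diff subquot_mapE sqclass_eq0.
  move=> /page_denP[y [z []]]; rewrite page_degE addrK -addSn addnK.
  move=> Fy _ Fz _ Dx'.
  have [Fx' FDx'] := page_numP _ _ _ _ Zx'.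
  have Fz' : tot_fil p (p%:Z + q) z by exact: tot_filS (leqnSn p) Fz.
  exists (x' - z).
    apply/page_numP; rewrite raddfB Dx' addrK.
    by split; [exact: tot_filB | rewrite !addnS].
  rewrite opprB addrCA addrC; apply: rpredD => //.
  apply/page_denP; exists z, 0; rewrite !raddf0 addr0; split=> //.
  have -> : tot_diff A z = tot_diff A x' - y by rewrite Dx' addrC addKr.
  apply: tot_filB; apply: tot_filS Fy || apply: tot_filS FDx'; lia.
have [P FP] := A_bounded (p%:Z + q + 1).
have [x' /page_numP[Fx' FDx'] Bxx'] := lift P; exists x' => //.
by apply/cocyclesP; split=> //; apply/FP/(tot_filS _ FDx'); lia.
Qed.

(** Let the boundary of an element z of F^{p+1-s}, s > r, lie in F^p. The class
    of z survives to the page s - 1, where its differential vanishes; hence the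
    boundary of z is, up to a cocycle of F^{p+1}, that of an element of
    F^{p+2-s}. Starting from F^0, finitely many steps lead to F^{p+1-r}, which
    is the subgroup that enters the definition of the page r. *)
Lemma coboundary_page_den p (q : int) (z : tot A) :
  collapses_at A r -> tot_fil 0 (p%:Z + q - 1) z ->
  tot_fil p (p%:Z + q) (tot_diff A z) -> tot_diff A z \in page_den r p q.
Proof.
move=> Ar; have lift s z' : tot_fil (p.+1 - (r + s)) (p%:Z + q - 1) z' ->
    tot_fil p (p%:Z + q) (tot_diff A z') -> tot_diff A z' \in page_den r p q.
  elim: s z' => [|s IHs] {}z Fz FDz.
    apply/page_denP; exists 0, z; rewrite !raddf0 add0r.
    by split=> //; rewrite -[r]addn0.
  have [lt_prs|le_rsp] := ltnP p (r + s).
    by apply: IHs => //; apply: tot_filS Fz; lia.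
  rewrite addnS subSS in Fz.
  set t := (r + s)%N in le_rsp IHs Fz *; set p' := (p - t)%N in Fz *.
  have pE : p = (p' + t)%N by rewrite subnK.
  pose q' := q + t%:Z - 1.
  have qE : q = q' - t%:Z + 1 by rewrite /q'; lia.
  have dE : p%:Z + q - 1 = p'%:Z + q' by rewrite pE qE; lia.
  have dE1 : p%:Z + q = p'%:Z + q' + 1 by rewrite -dE subrK.
  have Zz : z \in page_num t p' q'.
    by apply/page_numP; rewrite -pE -dE1 -dE.
  have := Ar t (leq_addr s r) p' q' (sqclass _ Zz).
  rewrite /page_diff subquot_mapE sqclass_eq0.
  move: IHs FDz; rewrite dE dE1 qE pE => IHs FDz.
  move=> /page_denP[y [w []]]; rewrite page_degE addrK => Fy _ Fw FDw DzE.
  rewrite DzE; apply: rpredD; last exact: IHs.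
  have Dy : tot_diff A y = 0.
    have -> : y = tot_diff A z - tot_diff A w by rewrite DzE addrK.
    by rewrite raddfB !tot_diffK subr0.
  apply/page_denP; exists y, 0; rewrite !raddf0 addr0 Dy page_degE.
  by split.
move=> Fz FDz; apply: (lift p.+1) => //; apply: tot_filS Fz.
by rewrite leqn0 subn_eq0 leq_addl.
Qed.

(** The projection sends the class of a cocycle to the class that the same
    cocycle has on the page: it is onto by page_num_cocycle and well defined by
    coboundary_page_den. *)
Lemma collapse_filtration_ext p (q : int) :
  collapses_at A r ->
  exists g : {additive tot_coh A p (p%:Z + q) -> page A r p q},
    filtration_ext g.
Proof.
move=> Ar.
have gB x : x \in cocycles p (p%:Z + q) -> x \in coboundaries (p%:Z + q) ->
    idfun x \in @page_den A r p q.
  move=> /cocyclesP[Fx _] /coboundariesP[z Fz xE].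
  by rewrite /= xE; apply: coboundary_page_den; rewrite -?xE.
pose g : {additive tot_coh A p (p%:Z + q) -> page A r p q} :=
  subquot_map (f := idfun) (@cocycles_num A r p q) gB.
exists g; split; last split.
- move=> x Zx Z'x; rewrite /g subquot_mapE.
  by apply/sqclass_eq; rewrite subrr rpred0.
- apply: raddf_inj => u; have [x [Zx ->]] := sqclassP u.
  by rewrite tot_coh_inclE !sqclass_eq0.
- move=> u; have [x [Zx ->]] := sqclassP u.
  rewrite /g subquot_mapE sqclass_eq0; split.
    move=> /page_denP[y [z [Fy _ Fz FDz xE]]].
    have {}xE : x = y + tot_diff A z by exact: xE.
    have /cocyclesP[Fx Dx] := Zx.
    have Zy : y \in cocycles p.+1 (p%:Z + q).
      apply/cocyclesP; split=> //.
      by rewrite -[RHS]Dx xE raddfD tot_diffK addr0.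
    exists (sqclass _ Zy); apply: etrans (tot_coh_inclE Zy) _.
    apply/sqclass_eq/coboundariesP; exists (- z).
      by rewrite -[- z]sub0r; apply: tot_filB => //; exact: tot_filS Fz.
    by rewrite [X in y - X]xE opprD addNKr raddfN.
  move=> [v]; have [y [Zy ->]] := sqclassP v.
  rewrite tot_coh_inclE => /sqclass_eq yx.
  have /cocyclesP[Fy Dy] := Zy; have /cocyclesP[Fx Dx] := Zx.
  change (x \in @page_den A r p q); rewrite -(subKr y x); apply: rpredB.
    apply/page_denP; exists y, 0; rewrite !raddf0 addr0 Dy.
    by split.
  refine (gB _ _ yx); apply/cocyclesP; rewrite raddfB Dx Dy subr0; split=> //.
  by apply: tot_filB => //; exact: tot_filS Fy.
- move=> u; have [x [Zx ->]] := sqclassP u.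
  have [x' Zx' Bxx'] := page_num_cocycle Ar Zx.
  exists (sqclass _ Zx'); rewrite /g subquot_mapE; apply/sqclass_eq.
  by rewrite -opprB rpredN.
Qed.

(** A cocycle with the zero class on the page is cohomologous to a cocycle one
    step further down the filtration, where the argument applies again. *)
Lemma tot_coh_eq0 p m :
  (forall p' (q' : int), (p <= p')%N -> p'%:Z + q' = m ->
     forall u : page A r p' q', u = 0) ->
  forall u : tot_coh A p m, u = 0.
Proof.
move=> pages0 u; have [x [Zx ->]] := sqclassP u; apply/sqclass_eq0.
have lift t : exists2 x', x' \in cocycles (p + t) m & x - x' \in coboundaries m.
  elim: t => [|t [x' Zx' Bxx']].
    by exists x; rewrite ?addn0 // subrr rpred0.
  have [q mE] : exists q : int, (p + t)%N%:Z + q = m.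
    by exists (m - (p + t)%N%:Z); rewrite addrC subrK.
  move: (Zx'); rewrite -[X in cocycles _ X]mE => /(cocycles_num r) Zrx'.
  have /sqclass_eq0/page_denP[y [z [Fy _ Fz FDz x'E]]] :=
    pages0 (p + t)%N q (leq_addr t p) mE (sqclass _ Zrx').
  rewrite mE in Fy Fz FDz; have /cocyclesP[Fx' Dx'] := Zx'.
  exists y.
    apply/cocyclesP; rewrite addnS; split=> //.
    by rewrite -[RHS]Dx' x'E raddfD tot_diffK addr0.
  have -> : x - y = x - x' + tot_diff A z by rewrite x'E opprD -!addrA addNr addr0.
  apply: rpredD => //; apply/coboundariesP; exists z => //.
  exact: tot_filS Fz.
have [P FP] := A_bounded m; have [x' /cocyclesP[Fx' _]] := lift P.
by rewrite (FP x') ?subr0 //; apply: tot_filS Fx'; lia.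
Qed.

(** When only two groups contribute to a degree, the cohomology is an extension
    of one by the other. *)
Lemma two_step_extension p (q q' : int) m :
  collapses_at A r -> p%:Z + q = m -> p.+1%:Z + q' = m ->
  (forall u : tot_coh A p.+2 m, u = 0) ->
  exists (f : {additive page A r p.+1 q' -> tot_coh A p m})
         (g : {additive tot_coh A p m -> page A r p q}),
    [/\ induced_by_id f, induced_by_id g & short_exact f g].
Proof.
move=> Ar pq pq' F2.
have ext p' (q'' : int) : p'%:Z + q'' = m ->
    exists g : {additive tot_coh A p' m -> page A r p' q''},
      induced_by_id g /\ short_exact (tot_coh_incl A p' m) g.
  by move=> <-; exact: collapse_filtration_ext.
have [g [g_id [inclI gker gS]]] := ext p q pq.
have [g' [g'_id [_ g'ker g'S]]] := ext p.+1 q' pq'.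
have g'I : injective g'.
  by apply: raddf_inj => b /g'ker[a <-]; rewrite (F2 a) raddf0.
have [s [g'K sK]] : exists s : {additive page A r p.+1 q' -> tot_coh A p.+1 m},
    cancel g' s /\ cancel s g'.
  by apply: isog_inv; exists (fun c => projT1 (cid (g'S c))) => [b|c];
    [apply: g'I|]; case: cid.
exists (tot_coh_incl A p m \o s : {additive page A r p.+1 q' -> tot_coh A p m}), g.
split=> //; last split=> //.
- move=> x Zx Z0x; have [Fx _] := page_numP _ _ _ _ Zx.
  have [_ Dx] := cocyclesP _ _ _ Z0x.
  have Z1x : x \in cocycles p.+1 m.
    by apply/cocyclesP; split=> //; rewrite -pq'.
  rewrite /= -(g'_id x Z1x Zx) g'K; apply: etrans (tot_coh_inclE Z1x) _.
  by apply/sqclass_eq; rewrite subrr rpred0.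
- exact: inj_comp inclI (can_inj sK).
- move=> b; rewrite gker; split=> [[a <-]|[a <-]]; last by exists (s a).
  by exists (g' a); rewrite /= g'K.
Qed.

End Convergence.

Lemma splits_eq0 (B C : zmodType) (g : {additive B -> C}) :
  (forall c : C, c = 0) -> splits g.
Proof.
move=> C0; exists (\0 : {additive C -> B}).
by move=> c; rewrite [RHS]C0 [LHS]C0.
Qed.

Lemma splits_ker0 (A B C : zmodType) (f : {additive A -> B})
    (g : {additive B -> C}) :
  short_exact f g -> (forall a : A, a = 0) -> splits g.
Proof.
move=> [_ gker gS] A0.
have gI : injective g.
  by apply: raddf_inj => b /gker[a <-]; rewrite (A0 a) raddf0.
have [s [_ sK]] : exists s : {additive C -> B}, cancel g s /\ cancel s g.
  by apply: isog_inv; exists (fun c => projT1 (cid (gS c))) => [b|c];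
    [apply: gI|]; case: cid.
by exists s.
Qed.

(** Used in the contrapositive: it detects a non-split extension of two groups
    of exponent o by an element that o does not kill. *)
Lemma splits_mulrn_eq0 (A B C : zmodType) (f : {additive A -> B})
    (g : {additive B -> C}) (o : nat) :
  short_exact f g -> splits g ->
  (forall a : A, a *+ o = 0) -> (forall c : C, c *+ o = 0) ->
  forall b : B, b *+ o = 0.
Proof.
move=> [_ gker _] [s sK] A0 C0 b.
have /gker[a fa] : g (b - s (g b)) = 0 by rewrite raddfB sK subrr.
have -> : b = f a + s (g b) by rewrite fa subrK.
by rewrite mulrnDl -raddfMn A0 raddf0 add0r -raddfMn C0 raddf0.
Qed.

(** * Filtered chain maps and homotopies *)

Section FilteredMaps.
Implicit Types (A B : double_complex) (p r : nat) (q m : int).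

Definition filtered_chain_map A B (f : tot A -> tot B) : Prop :=
  (forall p m x, tot_fil p m x -> tot_fil p m (f x)) /\
  (forall x, tot_diff B (f x) = f (tot_diff A x)).

(** A homotopy coming from the first direction of a double complex lowers the
    filtration by one, so that it is invisible only from the page 2 on. *)
Definition homotopic_id A (f : tot A -> tot A) : Prop :=
  exists s : {additive tot A -> tot A},
    (forall p m x, tot_fil p m x -> tot_fil p.-1 (m - 1) (s x)) /\
    (forall x, f x - x = tot_diff A (s x) + s (tot_diff A x)).

Lemma eq_homotopic_id A (f g : tot A -> tot A) :
  f =1 g -> homotopic_id f -> homotopic_id g.
Proof.
by move=> fg [s [sF sE]]; exists s; split=> // x; rewrite -fg.
Qed.

Definition filtered_equiv A B : Prop :=
  exists (f : {additive tot A -> tot B}) (g : {additive tot B -> tot A}),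
    [/\ filtered_chain_map f, filtered_chain_map g,
        homotopic_id (g \o f) & homotopic_id (f \o g)].

Lemma filtered_page_num A B (f : tot A -> tot B) r p q x :
  filtered_chain_map f -> x \in page_num r p q -> f x \in page_num r p q.
Proof.
move=> [fF fD] /page_numP[Fx FDx]; apply/page_numP.
by rewrite fD; split; exact: fF.
Qed.

Lemma filtered_page_den A B (f : {additive tot A -> tot B}) r p q x :
  filtered_chain_map f -> x \in page_den r p q -> f x \in page_den r p q.
Proof.
move=> [fF fD] /page_denP[y [z [Fy FDy Fz FDz ->]]]; apply/page_denP.
exists (f y), (f z); rewrite !fD.
by split; [exact: fF|exact: fF|exact: fF|exact: fF|exact: (raddfD f)].
Qed.

(** For x in F^p the homotopy takes its value in F^{p-1}, which is contained in
    F^{p+1-r} for r > 1; so f x - x is the sum of a boundary that the page r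
    divides out and of an element of F^{p+1}. *)
Lemma homotopic_page_den A (f : {additive tot A -> tot A}) r p q x :
  (1 < r)%N -> filtered_chain_map f -> homotopic_id f ->
  x \in page_num r p q -> f x - x \in page_den r p q.
Proof.
move=> r_gt1 ff [s [sF sE]] Zx; have [Fx FDx] := page_numP _ _ _ _ Zx.
have [Ffx FDfx] := page_numP _ _ _ _ (filtered_page_num ff Zx).
have FsDx : tot_fil p.+1 (p%:Z + q) (s (tot_diff A x)).
  by have := sF _ _ _ FDx; rewrite addrK; apply: tot_filS; lia.
apply/page_denP; exists (s (tot_diff A x)), (s x); split=> //.
- have -> : tot_diff A (s (tot_diff A x)) = tot_diff A (f x) - tot_diff A x.
    by rewrite -raddfB sE raddfD tot_diffK add0r.
  exact: tot_filB.
- by apply: tot_filS (sF _ _ _ Fx); lia.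
- have -> : tot_diff A (s x) = f x - x - s (tot_diff A x) by rewrite sE addrK.
  by apply: tot_filB; [exact: tot_filB|exact: tot_filS FsDx].
- by rewrite sE addrC.
Qed.

Lemma filtered_equiv_page A B r p q :
  (1 < r)%N -> filtered_equiv A B -> isog (page A r p q) (page B r p q).
Proof.
move=> r_gt1 [f [g [ff fg hgf hfg]]].
have gfA : filtered_chain_map (g \o f).
  split=> [p' m x Fx|x]; first exact/fg.1/ff.1.
  exact: etrans (fg.2 _) (congr1 g (ff.2 x)).
have fgB : filtered_chain_map (f \o g).
  split=> [p' m x Fx|x]; first exact/ff.1/fg.1.
  exact: etrans (ff.2 _) (congr1 f (fg.2 x)).
apply: (@isog_subquot _ _ _ _ _ _ f g) => x.
- exact: filtered_page_num.
- by move=> _; exact: filtered_page_den.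
- exact: filtered_page_num.
- by move=> _; exact: filtered_page_den.
- exact: (@homotopic_page_den _ (g \o f)).
- exact: (@homotopic_page_den _ (f \o g)).
Qed.

Lemma filtered_equiv_coh A B m :
  filtered_equiv A B -> isog (tot_coh A 0 m) (tot_coh B 0 m).
Proof.
move=> [f [g [ff fg hgf hfg]]].
have Zf C E (h : {additive tot C -> tot E}) x : filtered_chain_map h ->
    x \in cocycles 0 m -> h x \in cocycles 0 m.
  move=> [hF hD] /cocyclesP[Fx Dx]; apply/cocyclesP.
  by rewrite hD Dx raddf0; split=> //; exact: hF.
have Bf C E (h : {additive tot C -> tot E}) x : filtered_chain_map h ->
    x \in coboundaries m -> h x \in coboundaries m.
  move=> [hF hD] /coboundariesP[z Fz ->]; apply/coboundariesP.
  by exists (h z); [exact: hF|rewrite hD].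
have hB C (h : tot C -> tot C) x : homotopic_id h ->
    x \in cocycles 0 m -> h x - x \in coboundaries m.
  move=> [s [sF sE]] /cocyclesP[Fx Dx]; apply/coboundariesP.
  by exists (s x); [exact: sF Fx|rewrite sE Dx raddf0 addr0].
apply: (@isog_subquot _ _ _ _ _ _ f g) => x.
- exact: Zf.
- by move=> _; exact: Bf.
- exact: Zf.
- by move=> _; exact: Bf.
- exact: (@hB _ (g \o f)).
- exact: (@hB _ (f \o g)).
Qed.

Section TotMap.
Variables (A B : double_complex) (F : forall i j, {additive A i j -> B i j}).

Definition tot_map_fun (x : tot A) : tot B := fun i j => F i j (x i j).

Lemma tot_map_additive : zmod_morphism tot_map_fun.
Proof.
move=> x y; apply: dprod_ext => i; apply: dprod_ext => j.
exact: (raddfB (F i j) (x i j) (y i j)).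
Qed.

Definition tot_map : {additive tot A -> tot B} :=
  HB.pack tot_map_fun (GRing.isZmodMorphism.Build _ _ _ tot_map_additive).

Lemma tot_map_filtered :
  (forall i j x, F i.+1 j (dc_h i j x) = dc_h i j (F i j x)) ->
  (forall i j j' x, F i j' (dc_v i j j' x) = dc_v i j j' (F i j x)) ->
  filtered_chain_map tot_map.
Proof.
move=> Fh Fv; split=> [p m x Fx i j h|x].
  by rewrite -[LHS]/(F i j (x i j)) Fx ?raddf0.
apply: dprod_ext => i; apply: dprod_ext => j.
rewrite -[RHS]/(F i j (tot_diff_fun x i j)) -[LHS]/(tot_diff_fun _ i j).
rewrite /tot_diff_fun raddfD raddfMz Fv; congr (_ + _).
by case: i => [|i]; rewrite ?raddf0 // Fh.
Qed.

End TotMap.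

Section TotHomotopy.
Variables (A : double_complex) (F : forall i j, {additive A i j -> A i j}).
Variable S : forall i j, {additive A i.+1 j -> A i j}.

Definition tot_htpy_fun (x : tot A) : tot A := fun i j => S i j (x i.+1 j).

Lemma tot_htpy_additive : zmod_morphism tot_htpy_fun.
Proof.
move=> x y; apply: dprod_ext => i; apply: dprod_ext => j.
exact: (raddfB (S i j) (x i.+1 j) (y i.+1 j)).
Qed.

Definition tot_htpy : {additive tot A -> tot A} :=
  HB.pack tot_htpy_fun (GRing.isZmodMorphism.Build _ _ _ tot_htpy_additive).

Lemma tot_map_homotopic :
  (forall i j j' x, S i j' (dc_v i.+1 j j' x) = dc_v i j j' (S i j x)) ->
  (forall j x, F 0 j x - x = S 0 j (dc_h 0 j x)) ->
  (forall i j x, F i.+1 j x - x = dc_h i j (S i j x) + S i.+1 j (dc_h i.+1 j x)) ->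
  homotopic_id (tot_map F).
Proof.
move=> Sv SF0 SF; exists tot_htpy; split=> [p m x Fx i j h|x].
  rewrite -[LHS]/(S i j (x i.+1 j)) Fx ?raddf0 //.
  by case/orP: h => h; apply/orP; [left|right]; lia.
apply: dprod_ext => i; apply: dprod_ext => j.
change (F i j (x i j) - x i j =
  tot_diff_fun (tot_htpy_fun x) i j + S i j (tot_diff_fun x i.+1 j)).
rewrite /tot_diff_fun /tot_htpy_fun.
(* the two occurrences of the second differential cancel, as the sign changes *)
rewrite raddfD raddfMz Sv exprS mulN1r mulrNz.
case: i => [|i]; first by rewrite add0r SF0 addrCA subrr addr0.
by rewrite SF addrACA subrr addr0.
Qed.

End TotHomotopy.

End FilteredMaps.

(** * Maps out of free modules over the group ring *)

Section FreeModules.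
Variables (M N : c2mod) (E : {pred M}).

Definition comb_along (h : M -> N) (s : seq M) (a b : M -> int) : N :=
  \sum_(e <- s) (h e *~ a e + c2_act (h e) *~ b e).

Lemma equivariant_comb (u : {additive M -> N}) s a b :
  equivariant u -> u (c2_comb s a b) = comb_along u s a b.
Proof.
move=> ue; rewrite raddf_sum; apply: eq_bigr => e _.
by rewrite raddfD !raddfMz ue.
Qed.

Lemma basis_ext (u v : {additive M -> N}) :
  c2_basis E -> equivariant u -> equivariant v ->
  (forall e, e \in E -> u e = v e) -> forall x, u x = v x.
Proof.
move=> [Egen _] ue ve uv x; have [s [a [b [sE ->]]]] := Egen x.
rewrite !equivariant_comb // /comb_along !big_seq.
by apply: eq_bigr => e /sE/uv->.
Qed.

End FreeModules.

Lemma sum_count_mem (V : zmodType) (T : eqType) (s t : seq T) (F : T -> V) :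
  uniq t -> {subset s <= t} ->
  \sum_(e <- s) F e = \sum_(e <- t) F e *+ count_mem e s.
Proof.
move=> t_uniq; elim: s => [|x s IHs] st.
  by rewrite big_nil big1.
rewrite big_cons IHs => [|e es]; last by apply: st; rewrite inE es orbT.
under [RHS]eq_bigr do rewrite /= mulrnDr.
rewrite big_split /=; congr (_ + _).
rewrite (bigD1_seq x) ?st ?mem_head //= eqxx mulr1n big1 ?addr0 // => e.
by rewrite eq_sym => /negbTE->.
Qed.

Lemma comb_along_sub (M N : c2mod) (h : M -> N) s t a b : uniq t ->
  {subset s <= t} ->
  comb_along h s a b =
  comb_along h t (fun e => a e * (count_mem e s)%:Z)
                 (fun e => b e * (count_mem e s)%:Z).
Proof.
move=> t_uniq st; rewrite /comb_along (sum_count_mem _ t_uniq st).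
by apply: eq_bigr => e _; rewrite !mulrzA -!pmulrn mulrnDl.
Qed.

Lemma comb_alongB (M N : c2mod) (h : M -> N) s a b a' b' :
  comb_along h s (fun e => a e - a' e) (fun e => b e - b' e) =
  comb_along h s a b - comb_along h s a' b'.
Proof.
rewrite /comb_along -sumrB; apply: eq_bigr => e _.
by rewrite !mulrzBr opprD addrACA.
Qed.

Lemma c2_comb_along (M : c2mod) s a b :
  @c2_comb M s a b = comb_along id s a b.
Proof. by []. Qed.

(** Coordinates in the basis are only known to exist. So the extension of h is
    first a relation between a combination of basis elements and the same
    combination of their images; independence of the basis, applied to the
    difference of two combinations, makes it single-valued. *)
Lemma basis_extend (M N : c2mod) (E : {pred M}) (h : M -> N) :
  c2_basis E ->
  exists2 u : {additive M -> N}, equivariant u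
                               & forall e, e \in E -> u e = h e.
Proof.
move=> [Egen Efree].
pose G x y := exists s a b,
  [/\ {subset s <= E}, x = c2_comb s a b & y = comb_along h s a b].
have G0 y : G 0 y -> y = 0.
  move=> [s [a [b [sE s0 ->]]]].
  have us : {subset s <= undup s} by move=> e; rewrite mem_undup.
  rewrite (comb_along_sub _ _ _ (undup_uniq s) us).
  move: s0; rewrite c2_comb_along (comb_along_sub _ _ _ (undup_uniq s) us).
  move=> /esym/Efree-/(_ (undup_uniq s)) coef0.
  rewrite /comb_along big_seq big1 // => e /coef0[|-> ->].
    by move=> e'; rewrite mem_undup => /sE.
  by rewrite !mulr0z addr0.
have GB x y x' y' : G x y -> G x' y' -> G (x - x') (y - y').
  move=> [s [a [b [sE -> ->]]]] [s' [a' [b' [s'E -> ->]]]].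
  pose t := undup (s ++ s').
  have t_uniq : uniq t by exact: undup_uniq.
  have st : {subset s <= t} by move=> e; rewrite mem_undup mem_cat => ->.
  have s't : {subset s' <= t}.
    by move=> e; rewrite mem_undup mem_cat orbC => ->.
  rewrite !c2_comb_along !(comb_along_sub _ _ _ t_uniq st).
  rewrite !(comb_along_sub _ _ _ t_uniq s't) -!comb_alongB.
  exists t; do 2!eexists; split=> // e.
  by rewrite mem_undup mem_cat => /orP[/sE|/s'E].
have GT x y : G x y -> G (c2_act x) (c2_act y).
  move=> [s [a [b [sE -> ->]]]]; exists s, b, a; split=> //.
    rewrite raddf_sum; apply: eq_bigr => e _.
    by rewrite raddfD !raddfMz c2_actK addrC.
  rewrite raddf_sum; apply: eq_bigr => e _.
  by rewrite raddfD !raddfMz c2_actK addrC.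
have Gtot x : exists y, G x y.
  by have [s [a [b [sE xE]]]] := Egen x; exists (comb_along h s a b), s, a, b.
pose u x : N := projT1 (cid (Gtot x)).
have Gu x : G x (u x) by rewrite /u; case: cid.
have uE x y : G x y -> u x = y.
  by move=> /(GB _ _ _ _ (Gu x)); rewrite subrr => /G0/subr0_eq.
have uB : zmod_morphism u by move=> x y; apply/uE/GB.
pose ua : {additive M -> N} := HB.pack u (GRing.isZmodMorphism.Build _ _ _ uB).
exists ua => [x|e eE]; first exact/uE/GT.
apply: uE; exists [:: e], (fun=> 1), (fun=> 0); split.
- by move=> e'; rewrite inE => /eqP->.
- by rewrite /c2_comb big_seq1 mulr1z mulr0z addr0.
- by rewrite /comb_along big_seq1 mulr1z mulr0z addr0.
Qed.

Lemma free_lift (M N N' : c2mod) (v : {additive M -> N})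
    (p : {additive N' -> N}) :
  c2_free M -> equivariant v -> equivariant p ->
  (forall x, exists y, p y = v x) ->
  exists2 u : {additive M -> N'}, equivariant u & forall x, p (u x) = v x.
Proof.
move=> [E Ebasis] ve pe vp.
have [u ue uE] := basis_extend (fun x => projT1 (cid (vp x))) Ebasis.
exists u => //; apply: (basis_ext (u := p \o u) Ebasis) => // [x|e /uE/= ->].
  by rewrite /= ue pe.
by case: cid.
Qed.

(** * Free resolutions are unique up to homotopy *)

Lemma dependent_sequence (T : nat -> Type) (P : forall i, T i -> Prop)
    (R : forall i, T i -> T i.+1 -> Prop) (x0 : T 0%N) :
  P 0%N x0 ->
  (forall i x, P i x -> exists2 y, P i.+1 y & R i x y) ->
  exists f : forall i, T i,
    [/\ f 0%N = x0, forall i, P i (f i) & forall i, R i (f i) (f i.+1)].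
Proof.
move=> P0 step.
pose next i (x : {x | P i x}) : {y | P i.+1 y} :=
  let: exist2 y Py _ := cid2 (step i (sval x) (svalP x)) in exist _ y Py.
have nextR i x : R i (sval x) (sval (next i x)).
  by rewrite /next; case: cid2.
pose f := fix f i : {x | P i x} :=
  if i is i'.+1 return {x | P i x} then next i' (f i') else exist _ x0 P0.
exists (fun i => sval (f i)); split=> // i.
exact: (svalP (f i)).
Qed.

Section Resolutions.

Definition resolution_map (W W' : free_resolution)
    (u : forall i, {additive W i -> W' i}) : Prop :=
  [/\ forall i, equivariant (u i), forall x, res_aug W' (u 0%N x) = res_aug W x
    & forall i x, res_diff W' i (u i.+1 x) = u i (res_diff W i x)].

(** The augmentation plays the part of the differential out of the degree 0, so
    that exactness reads the same in all degrees. *)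
Definition res_cycle (W : free_resolution) i : W i -> Prop :=
  match i with
  | 0 => fun x => res_aug W x = 0
  | i'.+1 => fun x => res_diff W i' x = 0
  end.

Lemma res_cycleP (W : free_resolution) i (x : W i) :
  res_cycle x <-> exists y, res_diff W i y = x.
Proof. by case: i x => [|i] x; [exact: res_exact0|exact: res_exact]. Qed.

Lemma trivial_actK : involutive (@idfun int). Proof. by []. Qed.

Definition trivial_int : c2mod := C2Mod trivial_actK.

Variables W W' : free_resolution.

(** The lifting to the next degree is possible because the map constructed so
    far sends cycles, which are boundaries, to cycles; so this is the invariant
    of the recursion. *)
Lemma resolution_map_exists :
  exists u : forall i, {additive W i -> W' i}, resolution_map u.
Proof.
have [u0 u0e u0E] := free_lift (N := trivial_int) (v := res_aug W)
  (p := res_aug W') (res_free W 0) (res_aug_equiv (f := W))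
  (res_aug_equiv (f := W')) (fun x => res_aug_surj W' (res_aug W x)).
pose P i (u : {additive W i -> W' i}) :=
  equivariant u /\ forall x, res_cycle x -> res_cycle (u x).
pose R i (u : {additive W i -> W' i}) (u' : {additive W i.+1 -> W' i.+1}) :=
  forall x, res_diff W' i (u' x) = u (res_diff W i x).
have P0 : P 0%N u0 by split=> // x /= <-.
have step i u : P i u -> exists2 u', P i.+1 u' & R i u u'.
  move=> [ue uc].
  have [||||u' u'e u'E] := @free_lift (W i.+1) (W' i) (W' i.+1)
      (u \o res_diff W i) (res_diff W' i).
  - exact: res_free.
  - by move=> x /=; rewrite (res_diff_equiv (f := W)) ue.
  - exact: (res_diff_equiv (f := W')).
  - by move=> x; apply/res_cycleP/uc/res_cycleP; exists x.
  exists u' => //; split=> // x /= dx.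
  by rewrite u'E /= dx raddf0.
have [u [uE uP uR]] := dependent_sequence P0 step.
exists u; split=> [i|x|i x]; [by case: (uP i)|by rewrite uE|exact: uR].
Qed.

Definition resolution_htpy (u v : forall i, {additive W i -> W' i})
    (s : forall i, {additive W i -> W' i.+1}) : Prop :=
  [/\ forall i, equivariant (s i),
      forall x, u 0%N x - v 0%N x = res_diff W' 0 (s 0%N x)
    & forall i x, u i.+1 x - v i.+1 x =
        res_diff W' i.+1 (s i.+1 x) + s i (res_diff W i x)].

(** The recursion carries the part of the homotopy formula that the next lifting
    needs: on cycles, where the term s (d x) vanishes, the differential of the
    homotopy is already u - v. *)
Lemma resolution_htpy_exists (u v : forall i, {additive W i -> W' i}) :
  resolution_map u -> resolution_map v ->
  exists s : forall i, {additive W i -> W' i.+1}, resolution_htpy u v s.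
Proof.
move=> [ue ua ud] [ve va vd].
have uve i : equivariant (u i \- v i).
  by move=> x /=; rewrite ue ve raddfB.
have [||||s0 s0e s0E] := @free_lift (W 0%N) (W' 0%N) (W' 1%N)
    (u 0%N \- v 0%N) (res_diff W' 0).
- exact: res_free.
- exact: uve.
- exact: (res_diff_equiv (f := W')).
- by move=> x; apply/res_exact0; rewrite /= raddfB ua va subrr.
pose P i (s : {additive W i -> W' i.+1}) :=
  equivariant s /\ forall x, res_cycle x -> res_diff W' i (s x) = u i x - v i x.
pose R i (s : {additive W i -> W' i.+1}) (s' : {additive W i.+1 -> W' i.+2}) :=
  forall x, res_diff W' i.+1 (s' x) =
            u i.+1 x - v i.+1 x - s (res_diff W i x).
have P0 : P 0%N s0 by split=> // x _; rewrite s0E.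
have step i s : P i s -> exists2 s', P i.+1 s' & R i s s'.
  move=> [se sE].
  have [||||s' s'e s'E] := @free_lift (W i.+1) (W' i.+1) (W' i.+2)
      ((u i.+1 \- v i.+1) \- (s \o res_diff W i)) (res_diff W' i.+1).
  - exact: res_free.
  - move=> x; rewrite /= (res_diff_equiv (f := W)) se ue ve.
    by rewrite -!raddfB.
  - exact: (res_diff_equiv (f := W')).
  - move=> x; apply/res_exact; rewrite /= !raddfB /= ud vd sE ?subrr //.
    by apply/res_cycleP; exists x.
  exists s' => //; split=> // x /= dx.
  by rewrite s'E /= dx raddf0 subr0.
have [s [sE sP sR]] := dependent_sequence P0 step.
exists s; split=> [i|x|i x]; first by case: (sP i).
  by rewrite sE s0E.
by rewrite sR subrK.
Qed.

End Resolutions.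

Section ResolutionInvariance.
Variable D : c2complex.

Definition hom_pullback (W W' : free_resolution)
    (u : forall i, {additive W i -> W' i}) (ue : forall i, equivariant (u i))
    i j : {additive hom_double_complex W' D i j ->
                    hom_double_complex W D i j} :=
  hom_map (ue i) (@equivariant_id (D j)).

Lemma hom_pullback_filtered (W W' : free_resolution)
    (u : forall i, {additive W i -> W' i}) (ue : forall i, equivariant (u i)) :
  resolution_map u -> filtered_chain_map (tot_map (hom_pullback ue)).
Proof.
move=> [_ _ ud]; apply: tot_map_filtered => [i j f|i j j' f].
  apply: homC2_ext => x.
  change (val f (res_diff W' i (u i.+1 x)) = val f (u i (res_diff W i x))).
  by rewrite ud.
exact: homC2_ext.
Qed.

Lemma hom_pullback_homotopic (W : free_resolution)
    (u : forall i, {additive W i -> W i}) (ue : forall i, equivariant (u i)) :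
  resolution_map u -> homotopic_id (tot_map (hom_pullback ue)).
Proof.
move=> um.
have idm : resolution_map (fun i => @idfun (W i) : {additive W i -> W i}).
  by split.
have [s [se s0 sS]] := resolution_htpy_exists um idm.
have fB i j (f : homC2 (W i) (D j)) x y : val f (x - y) = val f x - val f y.
  by have /hom_predP[hB _] := valP f; rewrite hB.
have fD i j (f : homC2 (W i) (D j)) x y : val f (x + y) = val f x + val f y.
  by have := fB _ _ f (x + y) y; rewrite addrK => ->; rewrite subrK.
pose S i j : {additive hom_double_complex W D i.+1 j ->
                       hom_double_complex W D i j} :=
  hom_map (se i) (@equivariant_id (D j)).
apply: (@tot_map_homotopic _ _ S) => [i j j' f|j f|i j f].
- exact: homC2_ext.
- apply: homC2_ext => x; rewrite homC2B -[RHS]/(val f (res_diff W 0 (s 0%N x))).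
  by rewrite -s0 fB.
- apply: homC2_ext => x.
  change (val (hom_pullback ue i.+1 j f - f) x =
          val f (s i (res_diff W i x)) + val f (res_diff W i.+1 (s i.+1 x))).
  by rewrite -fD [s i _ + _]addrC -sS fB homC2B.
Qed.

(** Chain maps between two resolutions exist in both directions, and their
    composites are homotopic to the identity. Together with filtered_equiv_page
    this allows to compute all pages from 2 on with the smallest resolution. *)
Lemma resolution_invariance (W W' : free_resolution) :
  filtered_equiv (hom_double_complex W D) (hom_double_complex W' D).
Proof.
have [u um] := resolution_map_exists W' W.
have [v vm] := resolution_map_exists W W'.
have [[ue ua ud] [ve va vd]] := (um, vm).
have uvm : resolution_map (fun i => v i \o u i : {additive W' i -> W' i}).
  split=> [i x|x|i x] /=; first by rewrite ue ve.
    by rewrite va ua.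
  by rewrite vd ud.
have vum : resolution_map (fun i => u i \o v i : {additive W i -> W i}).
  split=> [i x|x|i x] /=; first by rewrite ve ue.
    by rewrite ua va.
  by rewrite ud vd.
have [uve _ _] := uvm; have [vue _ _] := vum.
exists (tot_map (hom_pullback ue)), (tot_map (hom_pullback ve)).
split; [exact: hom_pullback_filtered|exact: hom_pullback_filtered| |].
  apply: (eq_homotopic_id _ (hom_pullback_homotopic vue vum)) => x.
  apply: dprod_ext => i; apply: dprod_ext => j; exact: homC2_ext.
apply: (eq_homotopic_id _ (hom_pullback_homotopic uve uvm)) => x.
apply: dprod_ext => i; apply: dprod_ext => j; exact: homC2_ext.
Qed.

End ResolutionInvariance.

(** * The standard resolution *)

Section StandardResolution.

Definition std_swap_fun (x : int * int) : int * int := (x.2, x.1).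

Lemma std_swap_additive : zmod_morphism std_swap_fun. Proof. by []. Qed.

Definition std_swap : {additive int * int -> int * int} :=
  HB.pack std_swap_fun (GRing.isZmodMorphism.Build _ _ _ std_swap_additive).

Lemma std_swapK : involutive std_swap. Proof. by case. Qed.

(** The pair (a, b) is the element a + b g, where g is the generator. *)
Definition group_ring : c2mod := C2Mod std_swapK.

(** Multiplication by g - (-1)^i. *)
Definition std_diff_fun (i : nat) (x : group_ring) : group_ring :=
  (x.2 - (-1) ^+ i * x.1, x.1 - (-1) ^+ i * x.2).

Lemma std_diff_additive i : zmod_morphism (std_diff_fun i).
Proof.
by move=> [x1 x2] [y1 y2]; rewrite /std_diff_fun /=; congr (_, _) => /=; ring.
Qed.

Definition std_diff i : {additive group_ring -> group_ring} :=
  HB.pack (std_diff_fun i)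
    (GRing.isZmodMorphism.Build _ _ _ (std_diff_additive i)).

Definition std_aug_fun (x : group_ring) : int := x.1 + x.2.

Lemma std_aug_additive : zmod_morphism std_aug_fun.
Proof. by move=> [x1 x2] [y1 y2]; rewrite /std_aug_fun /=; ring. Qed.

Definition std_aug : {additive group_ring -> int} :=
  HB.pack std_aug_fun (GRing.isZmodMorphism.Build _ _ _ std_aug_additive).

Lemma group_ring_coord (u v : int) :
  ((1, 0) : group_ring) *~ u + c2_act ((1, 0) : group_ring) *~ v = (u, v).
Proof.
have fstM (x : int * int) z : (x *~ z).1 = x.1 * z.
  by rewrite -mulrzz; exact: (raddfMz fst).
have sndM (x : int * int) z : (x *~ z).2 = x.2 * z.
  by rewrite -mulrzz; exact: (raddfMz snd).
rewrite [LHS]surjective_pairing; congr (_, _).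
  change ((((1, 0) : int * int) *~ u).1 + (((0, 1) : int * int) *~ v).1 = u).
  by rewrite !fstM /= mul1r mul0r addr0.
change ((((1, 0) : int * int) *~ u).2 + (((0, 1) : int * int) *~ v).2 = v).
by rewrite !sndM /= mul1r mul0r add0r.
Qed.

Definition std_basis : {pred group_ring} := fun x => x == (1, 0).

Lemma group_ring_comb (s : seq group_ring) (a b : group_ring -> int) :
  {subset s <= std_basis} -> uniq s ->
  c2_comb s a b = if (1, 0) \in s then (a (1, 0), b (1, 0)) else 0.
Proof.
case: s => [|x [|y s]] sx; rewrite /c2_comb ?big_nil // ?big_seq1 => s_uniq.
  have /eqP xE : x == (1, 0) by exact: (sx x (mem_head _ _)).
  by rewrite xE mem_head group_ring_coord.
have /eqP xE : x == (1, 0) by exact: (sx x (mem_head _ _)).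
have /sx/eqP yE : y \in [:: x, y & s] by rewrite !in_cons eqxx orbT.
by move: s_uniq; rewrite xE yE cons_uniq mem_head.
Qed.

Lemma group_ring_free : c2_free group_ring.
Proof.
exists std_basis; split=> [[u v]|s a b s_uniq sx s0 e es].
  exists [:: (1, 0)], (fun=> u), (fun=> v).
  have sx : {subset [:: (1, 0)] <= std_basis}.
    by move=> x; rewrite mem_seq1 => /eqP->; exact: eqxx.
  by split=> //; rewrite group_ring_comb // mem_head.
have /eqP eE : e == (1, 0) by exact: sx.
move: s0; rewrite group_ring_comb // -eE es => /pair_equal_spec[-> ->].
by [].
Qed.

Lemma std_diff_equiv i : equivariant (std_diff i).
Proof. by []. Qed.

Lemma std_aug_equiv (x : group_ring) : std_aug (c2_act x) = std_aug x.
Proof. exact: addrC. Qed.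

Lemma std_exact i (x : group_ring) :
  std_diff i x = 0 <-> exists y, std_diff i.+1 y = x.
Proof.
case: x => x1 x2; split=> [/pair_equal_spec[/= /subr0_eq x2E _]|[[y1 y2] <-]].
  exists (0, x1); apply/pair_equal_spec; rewrite /= exprS x2E.
  by split; ring.
apply/pair_equal_spec; rewrite /= exprS -signr_odd.
by case: odd; split; ring.
Qed.

Lemma std_exact0 (x : group_ring) :
  std_aug x = 0 <-> exists y, std_diff 0 y = x.
Proof.
case: x => x1 x2; split=> [/= x0|[[y1 y2] <-]].
  exists (0, x1); apply/pair_equal_spec; move: x0; rewrite /std_aug_fun /=.
  by move=> x0; split; rewrite /=; lia.
by rewrite /= /std_aug_fun /=; lia.
Qed.

Lemma std_aug_surj m : exists x, std_aug x = m.
Proof. by exists (m, 0); rewrite /= /std_aug_fun addr0. Qed.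

(** The cellular chains of the infinite sphere with its antipodal action. *)
Definition std_resolution : free_resolution :=
  FreeResolution (res_obj := fun=> group_ring) (fun=> group_ring_free)
    std_diff_equiv std_aug_equiv std_exact std_exact0 std_aug_surj.

Section HomStd.
Variable M : c2mod.

Lemma hom_std_subproof (m : M) :
  (fun w : group_ring => m *~ w.1 + c2_act m *~ w.2) \in
  @hom_pred group_ring M.
Proof.
apply/hom_predP; split=> [x y|x] /=.
  by rewrite !mulrzBr opprD addrACA.
by rewrite raddfD !raddfMz c2_actK addrC.
Qed.

Definition hom_std (m : M) : homC2 group_ring M :=
  exist (fun f => f \in @hom_pred group_ring M) _ (hom_std_subproof m).

Lemma hom_stdE (m : M) w : val (hom_std m) w = m *~ w.1 + c2_act m *~ w.2.
Proof. by []. Qed.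

Lemma hom_std_gen (m : M) : val (hom_std m) (1, 0) = m.
Proof. by rewrite hom_stdE mulr0z addr0. Qed.

Lemma homC2_std_ext (f g : homC2 group_ring M) :
  val f (1, 0) = val g (1, 0) -> f = g.
Proof.
move=> fg; apply: homC2_ext => x.
have valD (h : homC2 group_ring M) : 
    exists2 ha : {additive group_ring -> M}, equivariant ha & val h =1 ha.
  have /hom_predP[hB he] := valP h.
  pose ha : {additive group_ring -> M} :=
    HB.pack (val h) (GRing.isZmodMorphism.Build _ _ _ hB).
  by exists ha.
have [[fa fe fE] [ga ge gE]] := (valD f, valD g).
have [E Ebasis] := group_ring_free.
rewrite fE gE.
have -> : x = ((1, 0) : group_ring) *~ x.1 + c2_act ((1, 0) : group_ring) *~ x.2.
  by rewrite group_ring_coord; case: x.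
by rewrite !raddfD !raddfMz fe ge -fE -gE fg.
Qed.

Lemma hom_stdB : zmod_morphism hom_std.
Proof. by move=> u v; apply: homC2_std_ext; rewrite homC2B !hom_std_gen. Qed.

HB.instance Definition _ :=
  GRing.isZmodMorphism.Build M (homC2 group_ring M) hom_std hom_stdB.

Lemma hom_std_val (f : homC2 group_ring M) : hom_std (val f (1, 0)) = f.
Proof. by apply: homC2_std_ext; rewrite hom_std_gen. Qed.

End HomStd.

End StandardResolution.

(** * Coordinates on the tensor square *)

Definition sg (a : int) : int := (-1) ^ a.

Lemma sgM a : sg a * sg a = 1. Proof. exact: signzM. Qed.

Lemma sg_cases a : sg a = 1 \/ sg a = -1.
Proof. by have := sgM a; move: (sg a) => s; nia. Qed.

Lemma sgS a : sg (a + 1) = - sg a.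
Proof. by rewrite /sg signzD mulrN1. Qed.

Lemma sgB a : sg (a - 1) = - sg a. Proof. exact: signzB1. Qed.

Lemma sg_sq a : sg (a * a) = sg a.
Proof.
have [m [->|->]] : exists m, a = m + m \/ a = m + m + 1.
  exists (a %/ 2)%Z; have := divz_eq a 2.
  have : (0 <= (a %% 2)%Z < 2) by rewrite modz_ge0 ?ltz_pmod.
  by lia.
  rewrite [X in _ = X]/sg signzD signzM.
  rewrite (_ : (m + m) * (m + m) = (m + m) * m + (m + m) * m); last by ring.
  by rewrite /sg signzD signzM.
rewrite sgS [X in _ = - X]/sg signzD signzM.
rewrite (_ : (m + m + 1) * (m + m + 1) =
  (2 * m * m + 2 * m) + (2 * m * m + 2 * m) + 1); last by ring.
by rewrite sgS /sg signzD signzM.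
Qed.

Section TensorCoordinates.
Variables (n : nat) (k : int).

Implicit Types a b c e s t j : int.

(** The element a y (x) y + b x (x) y + c y (x) x + e x (x) x, where x and y are
    the generators in the degrees k - 1 and k. *)
Definition tens_coef a b c e s t : int :=
  if s == k then (if t == k then a else if t == k - 1 then c else 0)
  else if s == k - 1 then
    (if t == k then b else if t == k - 1 then e else 0)
  else 0.

Definition tens_quad a b c e : tens k :=
  fun s t => const_mx (tens_coef a b c e s t).

Lemma C_rankE s : C_rank k s = nat_of_bool ((s == k - 1) || (s == k)).
Proof. by []. Qed.

Lemma C_rank_gt0 s : 'I_(C_rank k s) -> s = k - 1 \/ s = k.
Proof.
rewrite C_rankE; have [->|_] := eqVneq s (k - 1); first by left.
by have [->|_ []] := eqVneq s k; first right.
Qed.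

Lemma C_rank_k : C_rank k k = 1%N. Proof. by rewrite C_rankE eqxx orbT. Qed.

Lemma C_rank_k1 : C_rank k (k - 1) = 1%N. Proof. by rewrite C_rankE eqxx. Qed.

Lemma k1_neq_k : (k - 1 == k) = false. Proof. by lia. Qed.

Lemma tens_coef_yy a b c e : tens_coef a b c e k k = a.
Proof. by rewrite /tens_coef eqxx. Qed.

Lemma tens_coef_xy a b c e : tens_coef a b c e (k - 1) k = b.
Proof. by rewrite /tens_coef k1_neq_k !eqxx. Qed.

Lemma tens_coef_yx a b c e : tens_coef a b c e k (k - 1) = c.
Proof. by rewrite /tens_coef k1_neq_k !eqxx. Qed.

Lemma tens_coef_xx a b c e : tens_coef a b c e (k - 1) (k - 1) = e.
Proof. by rewrite /tens_coef k1_neq_k !eqxx. Qed.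

Definition tens_coefE :=
  (tens_coef_yy, tens_coef_xy, tens_coef_yx, tens_coef_xx).

(** The matrices at stake have at most one entry, which the sum of the entries
    gives without a cast of the dimensions. *)
Definition entry_sum r1 r2 (X : 'M[int]_(r1, r2)) : int :=
  \sum_i \sum_j X i j.

Lemma entry_sum_const r1 r2 z :
  entry_sum (const_mx z : 'M_(r1, r2)) = z *+ r2 *+ r1.
Proof.
rewrite /entry_sum -[r1 in RHS]card_ord -sumr_const; apply: eq_bigr => i _.
by rewrite -[r2 in RHS]card_ord -sumr_const; apply: eq_bigr => j _; rewrite mxE.
Qed.

Lemma entry_sumE r1 r2 (X : 'M[int]_(r1, r2)) : (r1 <= 1)%N -> (r2 <= 1)%N ->
  X = const_mx (entry_sum X).
Proof.
case: r1 X => [X _ _|[|//] X _]; first by apply/matrixP => -[].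
case: r2 X => [X _|[|//] X _]; first by apply/matrixP => i [].
apply/matrixP => i j; rewrite mxE /entry_sum big_ord1 big_ord1.
by rewrite [i]ord1 [j]ord1.
Qed.

Lemma C_rank_le1 s : (C_rank k s <= 1)%N.
Proof. by rewrite C_rankE; case: orb. Qed.

Lemma tens_ext (x y : tens k) :
  (forall s t, (s = k - 1 \/ s = k) -> (t = k - 1 \/ t = k) ->
     entry_sum (x s t) = entry_sum (y s t)) -> x = y.
Proof.
move=> xy; apply: dprod_ext => s; apply: dprod_ext => t.
apply/matrixP => i j; rewrite (entry_sumE (x s t)) ?C_rank_le1 //.
rewrite (entry_sumE (y s t)) ?C_rank_le1 // !mxE.
by apply: xy; [exact: C_rank_gt0 i|exact: C_rank_gt0 j].
Qed.

Lemma entry_quad a b c e s t : (s = k - 1 \/ s = k) -> (t = k - 1 \/ t = k) ->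
  entry_sum (tens_quad a b c e s t) = tens_coef a b c e s t.
Proof.
rewrite entry_sum_const.
by move=> [->|->] [->|->]; rewrite ?C_rank_k ?C_rank_k1 !mulr1n.
Qed.

Definition D_res_fun j (x : tens k) : tens k :=
  fun s t => if s + t == j then x s t else 0.

Lemma D_res_subproof j x : D_res_fun j x \in tens_deg j.
Proof. by apply/tens_degP => s t /negbTE h; rewrite /D_res_fun h. Qed.

(** The four coefficients are given in every degree j, although at most two of
    them matter (see D_quad_eq): so no case distinction on j enters the type,
    and one quadruple describes an element of the total complex. *)
Definition D_quad j a b c e : D_obj k j :=
  exist (fun x => x \in tens_deg j) _ (D_res_subproof j (tens_quad a b c e)).

Lemma D_quad_ext j (x y : D_obj k j) :
  (forall s t, (s = k - 1 \/ s = k) -> (t = k - 1 \/ t = k) -> s + t = j ->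
     entry_sum (val x s t) = entry_sum (val y s t)) -> x = y.
Proof.
move=> xy; apply: val_inj; apply: tens_ext => s t hs ht.
have [/xy|stj] := eqVneq (s + t) j; first exact.
have /tens_degP hx := valP x; have /tens_degP hy := valP y.
by rewrite hx // hy.
Qed.

Lemma D_quadE j a b c e s t : (s = k - 1 \/ s = k) -> (t = k - 1 \/ t = k) ->
  s + t = j -> entry_sum (val (D_quad j a b c e) s t) = tens_coef a b c e s t.
Proof.
move=> hs ht stj; rewrite /= /D_res_fun stj eqxx.
exact: entry_quad.
Qed.

Lemma D_quad_eq j a b c e a' b' c' e' :
  D_quad j a b c e = D_quad j a' b' c' e' <->
  [/\ j = k + k -> a = a', j = k + k - 1 -> b = b' /\ c = c'
    & j = k + k - 2 -> e = e'].
Proof.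
split=> [qq|[ha hbc he]].
  have qE s t (hs : s = k - 1 \/ s = k) (ht : t = k - 1 \/ t = k)
      (st : s + t = j) : tens_coef a b c e s t =
      tens_coef a' b' c' e' s t by rewrite -!(D_quadE _ _ _ _ hs ht st) qq.
  split=> [jE|jE|jE].
  - have := qE k k; rewrite !tens_coefE; apply; by [right|].
  - split.
      have := qE (k - 1) k; rewrite !tens_coefE; apply; [by left|by right|lia].
    have := qE k (k - 1); rewrite !tens_coefE; apply; [by right|by left|lia].
  - have := qE (k - 1) (k - 1); rewrite !tens_coefE; apply; by [left|lia].
apply: D_quad_ext => s t hs ht st; rewrite !D_quadE //.
case: hs ht st => [->|->] [->|->] st; rewrite !tens_coefE.
- by apply: he; lia.
- by apply: (hbc _).1; lia.
- by apply: (hbc _).2; lia.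
- by apply: ha; lia.
Qed.

Lemma D_quad_surj j (x : D_obj k j) :
  x = D_quad j (entry_sum (val x k k)) (entry_sum (val x (k - 1) k))
               (entry_sum (val x k (k - 1))) (entry_sum (val x (k - 1) (k - 1))).
Proof.
apply: D_quad_ext => s t hs ht st; rewrite D_quadE //.
by case: hs ht {st} => [->|->] [->|->]; rewrite tens_coefE.
Qed.

Lemma entry_sumB r1 r2 (X Y : 'M[int]_(r1, r2)) :
  entry_sum (X - Y) = entry_sum X - entry_sum Y.
Proof.
rewrite /entry_sum -sumrB; apply: eq_bigr => i _.
by rewrite -sumrB; apply: eq_bigr => j _; rewrite !mxE.
Qed.

Lemma entry_sumZ r1 r2 z (X : 'M[int]_(r1, r2)) :
  entry_sum (z *: X) = z * entry_sum X.
Proof.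
rewrite /entry_sum mulr_sumr; apply: eq_bigr => i _.
by rewrite mulr_sumr; apply: eq_bigr => j _; rewrite mxE.
Qed.

Lemma entry_sumT r1 r2 (X : 'M[int]_(r1, r2)) : entry_sum X^T = entry_sum X.
Proof.
rewrite /entry_sum exchange_big; apply: eq_bigr => i _.
by apply: eq_bigr => j _; rewrite mxE.
Qed.

Definition entry_fun j s t (x : D_obj k j) : int := entry_sum (val x s t).

Lemma entry_additive j s t : zmod_morphism (@entry_fun j s t).
Proof. by move=> x y; rewrite /entry_fun raddfB; exact: entry_sumB. Qed.

Definition entry j s t : {additive D_obj k j -> int} :=
  HB.pack (@entry_fun j s t)
    (GRing.isZmodMorphism.Build _ _ _ (@entry_additive j s t)).

Lemma D_quadB j a b c e a' b' c' e' :
  D_quad j (a - a') (b - b') (c - c') (e - e') =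
  D_quad j a b c e - D_quad j a' b' c' e'.
Proof.
apply: D_quad_ext => s t hs ht st.
rewrite -![entry_sum _]/(entry j s t _) raddfB.
rewrite ![entry j s t _]D_quadE //.
by case: hs ht {st} => [->|->] [->|->]; rewrite !tens_coefE.
Qed.

Lemma D_quad0 j : D_quad j 0 0 0 0 = 0.
Proof. by have := D_quadB j 0 0 0 0 0 0 0 0; rewrite !subrr. Qed.

Lemma D_quadD j a b c e a' b' c' e' :
  D_quad j (a + a') (b + b') (c + c') (e + e') =
  D_quad j a b c e + D_quad j a' b' c' e'.
Proof.
apply: D_quad_ext => s t hs ht st.
rewrite -![entry_sum _]/(entry j s t _) raddfD.
rewrite ![entry j s t _]D_quadE //.
by case: hs ht {st} => [->|->] [->|->]; rewrite !tens_coefE.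
Qed.

Lemma D_quadMz j a b c e z :
  D_quad j (a * z) (b * z) (c * z) (e * z) = D_quad j a b c e *~ z.
Proof.
apply: D_quad_ext => s t hs ht st.
rewrite -![entry_sum _]/(entry j s t _) raddfMz mulrzz.
rewrite ![entry j s t _]D_quadE //.
by case: hs ht {st} => [->|->] [->|->]; rewrite !tens_coefE.
Qed.

Lemma D_quad_act j a b c e :
  c2_act (D_quad j a b c e) = D_quad j (sg k * a) c b (- sg k * e).
Proof.
apply: D_quad_ext => s t hs ht st; rewrite D_quadE //.
rewrite -[val _]/(tens_swap k (val (D_quad j a b c e))) tens_swapE.
have ts : t + s = j by rewrite addrC.
rewrite entry_sumZ entry_sumT D_quadE // -/(sg (s * t)).
have sg_even : sg (k * (k - 1)) = 1.
  by rewrite mulrBr mulr1 /sg signzB -/(sg _) sg_sq sgM.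
case: hs ht {st ts} => [->|->] [->|->]; rewrite !tens_coefE.
- by rewrite sg_sq sgB.
- by rewrite [(k - 1) * k]mulrC sg_even mul1r.
- by rewrite sg_even mul1r.
- by rewrite sg_sq.
Qed.

Lemma entry_mull r1 r2 r3 (X : 'M[int]_(r1, r2)) (Y : 'M[int]_(r2, r3)) :
  (r2 <= 1)%N -> entry_sum (X *m Y) = entry_sum X * entry_sum Y.
Proof.
case: r2 X Y => [|[|//]] X Y _; rewrite /entry_sum.
  rewrite [X in _ = _ * X]big_ord0 mulr0 big1 // => i _; rewrite big1 // => j _.
  by rewrite mxE big_ord0.
rewrite big_ord1 mulr_suml; apply: eq_bigr => i _; rewrite big_ord1 mulr_sumr.
by apply: eq_bigr => j _; rewrite mxE big_ord1.
Qed.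

Lemma entry_C_diff s t :
  entry_sum (C_diff n k s t) = if (s == k - 1) && (t == k) then n%:Z else 0.
Proof.
rewrite entry_sum_const.
have [->|_] := eqVneq s (k - 1); last by rewrite !mul0rn.
have [->|_] := eqVneq t k; last by rewrite !mul0rn.
by rewrite C_rank_k C_rank_k1.
Qed.

Lemma D_quad_diff j a b c e :
  D_diff n k (j - 1) j (D_quad (j - 1) a b c e) =
  D_quad j (n%:Z * (b + sg k * c)) (- sg k * n%:Z * e) (n%:Z * e) 0.
Proof.
apply: D_quad_ext => s t hs ht st; rewrite D_quadE //.
rewrite -[val _]/(tens_diff n k (val (D_quad (j - 1) a b c e)) *+
  (j == j - 1 + 1)) subrK eqxx mulr1n tens_diffE.
rewrite -[X in _ + X]opprK entry_sumB -scaleN1r !entry_sumZ.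
rewrite !entry_mull ?C_rank_le1 // entry_sumT !entry_C_diff -/(sg s).
rewrite !(inj_eq (addIr (- 1 : int))).
pose q := val (D_quad (j - 1) a b c e); rewrite -/q.
set X := entry_sum (q (s - 1) t); set Y := entry_sum (q s (t - 1)).
have XE : s = k -> X = tens_coef a b c e (k - 1) t.
  by move=> sk; rewrite /X /q sk D_quadE //; [left|lia].
have YE : t = k -> Y = tens_coef a b c e s (k - 1).
  by move=> tk; rewrite /Y /q tk D_quadE //; [left|lia].
move: X Y XE YE => X Y.
case: hs ht st => [->|->] [->|->] st; rewrite ?eqxx ?k1_neq_k /= => XE YE.
- by rewrite !tens_coefE; ring.
- by rewrite (YE erefl) !tens_coefE sgB; ring.
- by rewrite (XE erefl) !tens_coefE; ring.
- by rewrite (XE erefl) (YE erefl) !tens_coefE; ring.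
Qed.

End TensorCoordinates.

(** * Coordinates on the total complex *)

Section TotalCoordinates.
Variables (n : nat) (k : int).

Let A := hom_double_complex std_resolution (D_complex n k).

Implicit Types (p r : nat) (q m N a b c e : int).

(** With N = m - 2 k the coefficients a, (b, c) and e of an element of degree m
    have the first degrees N, N + 1 and N + 2; the condition fil p says that the
    element lies in F^p. A coefficient whose first degree is negative is lost in
    tot_elt, so that only the quadruples that satisfy fil 0 are determined by
    their image. *)
Definition tot_elt m a b c e : tot A :=
  fun i j => if i%:Z + j == m then hom_std (D_quad k j a b c e) else 0.

Definition fil p N a b c e : Prop :=
  [/\ N < p%:Z -> a = 0, N + 1 < p%:Z -> b = 0 /\ c = 0
    & N + 2 < p%:Z -> e = 0].

(** The boundary of a quadruple: the resolution contributes the action of the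
    generator of C_2 minus (-1)^i, and the tensor square contributes the terms
    with n, with the sign (-1)^i of the total complex. *)
Definition da N a b c : int := (sg k - sg N) * a - sg N * n%:Z * (b + sg k * c).
Definition db N b c e : int := c + sg N * b - sg N * sg k * n%:Z * e.
Definition dc N b c e : int := b + sg N * c + sg N * n%:Z * e.
Definition de N e : int := (- sg k - sg N) * e.

Definition dfil p N a b c e : Prop :=
  fil p (N + 1) (da N a b c) (db N b c e) (dc N b c e) (de N e).

Lemma tot_eltB m a b c e a' b' c' e' :
  tot_elt m (a - a') (b - b') (c - c') (e - e') =
  tot_elt m a b c e - tot_elt m a' b' c' e'.
Proof.
apply: dprod_ext => i; apply: dprod_ext => j.
rewrite [RHS]dprodB /tot_elt.
by case: eqP; rewrite ?subr0 // D_quadB raddfB.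
Qed.

Lemma tot_eltD m a b c e a' b' c' e' :
  tot_elt m (a + a') (b + b') (c + c') (e + e') =
  tot_elt m a b c e + tot_elt m a' b' c' e'.
Proof.
apply: dprod_ext => i; apply: dprod_ext => j.
rewrite [RHS]dprodD /tot_elt.
by case: eqP; rewrite ?addr0 // D_quadD raddfD.
Qed.

Lemma tot_eltMz m a b c e z :
  tot_elt m (a * z) (b * z) (c * z) (e * z) = tot_elt m a b c e *~ z.
Proof.
have projMz (x : tot A) i j : (x *~ z) i j = x i j *~ z.
  have pB : zmod_morphism (fun x : tot A => x i j) by [].
  pose pr : {additive tot A -> A i j} :=
    HB.pack (fun x : tot A => x i j) (GRing.isZmodMorphism.Build _ _ _ pB).
  exact: (raddfMz pr).
apply: dprod_ext => i; apply: dprod_ext => j; rewrite projMz /tot_elt.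
by case: eqP; rewrite ?mul0rz // D_quadMz raddfMz.
Qed.

Lemma hdc_v_std i j j' x :
  hdc_v std_resolution (D_complex n k) i j j' (hom_std x) =
  hom_std (D_diff n k j j' x).
Proof. by apply: homC2_std_ext; rewrite hom_std_gen hom_mapE hom_std_gen. Qed.

Lemma hdc_h_std i j (x : D_obj k j) :
  hdc_h std_resolution (D_complex n k) i j (hom_std x) =
  hom_std (c2_act x - x *~ (-1) ^+ i).
Proof.
apply: homC2_std_ext; rewrite hom_std_gen hom_mapE.
rewrite -[LHS]/(x *~ (0 - (-1) ^+ i * 1) + c2_act x *~ (1 - (-1) ^+ i * 0)).
by rewrite mulr1 mulr0 subr0 sub0r mulrNz mulr1z addrC.
Qed.

Lemma tot_diff_elt m a b c e : let N := m - (k + k) in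
  fil 0 N a b c e ->
  tot_diff A (tot_elt m a b c e) =
  tot_elt (m + 1) (da N a b c) (db N b c e) (dc N b c e) (de N e).
Proof.
move=> N [Fa Fbc Fe].
apply: dprod_ext => i; apply: dprod_ext => j.
change (tot_diff_fun (tot_elt m a b c e) i j = 
  if i%:Z + j == m + 1 then hom_std
    (D_quad k j (da N a b c) (db N b c e) (dc N b c e) (de N e)) else 0).
rewrite /tot_diff_fun /tot_elt.
have -> : (i%:Z + (j - 1) == m) = (i%:Z + j == m + 1) by lia.
case: eqP => [ijE|ijm]; last first.
  rewrite raddf0 mul0rz addr0; case: i ijm => // i ijm.
  by case: eqP => [|_]; [lia|rewrite raddf0].
have sgi : (-1) ^+ i = sg (m + 1 - j) by rewrite -ijE addrK.
rewrite [dc_v _ _ _ _]hdc_v_std -raddfMz D_quad_diff -D_quadMz sgi.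
have s0 : j = k + k -> sg (m + 1 - j) = - sg N.
  by move=> ->; rewrite addrAC sgS.
have s1 : j = k + k - 1 -> sg (m + 1 - j) = sg N.
  move=> ->; rewrite -[RHS]opprK -!sgS; congr (sg _); rewrite /N; lia.
have s2 : j = k + k - 2 -> sg (m + 1 - j) = - sg N.
  move=> ->; rewrite -[sg N]opprK -!sgS; congr (sg _); rewrite /N; lia.
case: i ijE sgi => [|i] ijE sgi.
  rewrite add0r; congr (hom_std _); apply/D_quad_eq; rewrite /da /db /dc /de.
  split=> jk.
  - by rewrite s0 // Fa; [ring|rewrite /N; lia].
  - have [-> ->] : b = 0 /\ c = 0 by apply: Fbc; rewrite /N; lia.
    by rewrite s1 //; split; ring.
  - by rewrite Fe; [ring|rewrite /N; lia].
have sgi' : (-1) ^+ i = - sg (m + 1 - j) by rewrite -sgi exprS mulN1r opprK.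
have -> : i%:Z + j == m by lia.
rewrite [dc_h _ _ _]hdc_h_std sgi' [c2_act _]D_quad_act -D_quadMz -D_quadB.
move: s0 s1 s2; set s := sg (m + 1 - j) => s0 s1 s2.
rewrite -raddfD -D_quadD; congr (hom_std _); apply/D_quad_eq.
rewrite /da /db /dc /de.
split=> jk; first by rewrite s0 //; ring.
  by rewrite s1 //; split; ring.
by rewrite s2 //; ring.
Qed.

Lemma tot_fil_elt p m a b c e : let N := m - (k + k) in
  fil 0 N a b c e -> tot_fil p m (tot_elt m a b c e) <-> fil p N a b c e.
Proof.
move=> N [Fa Fbc Fe]; split=> [Fx|[Ga Gbc Ge] i j].
  have coord0 i j : (i < p)%N -> i%:Z + j = m ->
      D_quad k j a b c e = D_quad k j 0 0 0 0.
    move=> ip ijm; have := Fx i j; rewrite ip => /(_ isT).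
    rewrite /tot_elt ijm eqxx => q0; rewrite D_quad0.
    by rewrite -[LHS]hom_std_gen q0 homC2_0.
  have natN M : 0 <= M -> exists i, i%:Z = M by case: M => // i _; exists i.
  split=> lt_p.
  - have [/natN[i iN]|/Fa//] : 0 <= N \/ N < 0 by lia.
    have /D_quad_eq[q _ _] := coord0 i (k + k) ltac:(lia) ltac:(lia).
    exact: q.
  - have [/natN[i iN]|/Fbc//] : 0 <= N + 1 \/ N + 1 < 0 by lia.
    have /D_quad_eq[_ q _] := coord0 i (k + k - 1) ltac:(lia) ltac:(lia).
    exact: q.
  - have [/natN[i iN]|/Fe//] : 0 <= N + 2 \/ N + 2 < 0 by lia.
    have /D_quad_eq[_ _ q] := coord0 i (k + k - 2) ltac:(lia) ltac:(lia).
    exact: q.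
rewrite /tot_elt; have [ijm|//] := eqVneq (i%:Z + j) m; rewrite orbF => ip.
have -> : D_quad k j a b c e = 0.
  rewrite -D_quad0; apply/D_quad_eq; split=> jk.
  - by apply: Ga; rewrite /N; lia.
  - by apply: Gbc; rewrite /N; lia.
  - by apply: Ge; rewrite /N; lia.
exact: raddf0.
Qed.

Lemma tot_elt_surj m (x : tot A) : tot_fil 0 m x ->
  exists a b c e, fil 0 (m - (k + k)) a b c e /\ x = tot_elt m a b c e.
Proof.
move=> Fx; set N := m - (k + k).
pose co M j s t : int :=
  if 0 <= M then entry k j s t (val (x `|M|%N j) (1, 0)) else 0.
exists (co N (k + k) k k), (co (N + 1) (k + k - 1) (k - 1) k),
  (co (N + 1) (k + k - 1) k (k - 1)), (co (N + 2) (k + k - 2) (k - 1) (k - 1)).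
split.
  by split=> M0; rewrite /co leNgt M0.
apply: dprod_ext => i; apply: dprod_ext => j; rewrite /tot_elt.
have [ijm|ijm] := eqVneq (i%:Z + j) m; last by rewrite Fx // ijm orbT.
have coE M s t : M = i%:Z ->
    co M j s t = entry k j s t (val (x i j) (1, 0)) by move=> ->; rewrite /co.
rewrite -[LHS]hom_std_val; congr (hom_std _); rewrite [LHS]D_quad_surj.
apply/D_quad_eq; split=> jk; rewrite -jk !coE // /N; lia.
Qed.

Lemma tot_elt0 m : tot_elt m 0 0 0 0 = 0.
Proof. by have := tot_eltB m 0 0 0 0 0 0 0 0; rewrite !subrr. Qed.

Lemma filS p p' N a b c e :
  (p' <= p)%N -> fil p N a b c e -> fil p' N a b c e.
Proof.
move=> p'p [Fa Fbc Fe].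
by split=> Np; [apply: Fa|apply: Fbc|apply: Fe]; lia.
Qed.

Lemma dfil0 N a b c e : fil 0 N a b c e -> dfil 0 N a b c e.
Proof.
move=> [Fa Fbc Fe]; rewrite /dfil /da /db /dc /de; split=> N0.
- by rewrite Fa; [have [-> ->] := Fbc N0; ring|lia].
- rewrite Fe; last by lia.
  by have [-> ->] : b = 0 /\ c = 0 by [apply: Fbc; lia]; split; ring.
- by rewrite Fe; [ring|lia].
Qed.

Lemma fil0 p N : fil p N 0 0 0 0. Proof. by []. Qed.

Lemma filB p N a b c e a' b' c' e' :
  fil p N a b c e -> fil p N a' b' c' e' ->
  fil p N (a - a') (b - b') (c - c') (e - e').
Proof.
move=> [Fa Fbc Fe] [Fa' Fbc' Fe']; split=> Np.
- by rewrite Fa ?Fa'.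
- by have [[-> ->] [-> ->]] := (Fbc Np, Fbc' Np).
- by rewrite Fe ?Fe'.
Qed.

Lemma filD p N a b c e a' b' c' e' :
  fil p N a b c e -> fil p N a' b' c' e' ->
  fil p N (a + a') (b + b') (c + c') (e + e').
Proof.
move=> Fv Fv'; have := filB Fv (filB (fil0 p N) Fv').
by rewrite !sub0r !opprK.
Qed.

Lemma tot_elt_inj m a b c e a' b' c' e' : let N := m - (k + k) in
  fil 0 N a b c e -> fil 0 N a' b' c' e' ->
  tot_elt m a b c e = tot_elt m a' b' c' e' ->
  [/\ a = a', b = b', c = c' & e = e'].
Proof.
move=> N Fv Fv' vv'; have Fvv' := filB Fv Fv'.
have [] : fil (absz (N + 3)) N (a - a') (b - b') (c - c') (e - e').
  by apply/tot_fil_elt => //; rewrite tot_eltB vv' subrr.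
move=> Ha Hbc He.
have [] : fil 0 N (a - a') (b - b') (c - c') (e - e') by [].
move=> Ga Gbc Ge.
have a0 : a - a' = 0 by have [/Ga//|?] := ltP N 0; apply: Ha; lia.
have [b0 c0] : b - b' = 0 /\ c - c' = 0.
  by have [/Gbc//|?] := ltP (N + 1) 0; apply: Hbc; lia.
have e0 : e - e' = 0 by have [/Ge//|?] := ltP (N + 2) 0; apply: He; lia.
by split; lia.
Qed.

(** The numerator and the denominator of the page (r, p), in coordinates. *)
Definition qnum r p N a b c e : Prop :=
  fil p N a b c e /\ dfil (p + r) N a b c e.

Definition qden r p N a b c e : Prop :=
  exists a1 b1 c1 e1 a2 b2 c2 e2,
  [/\ fil p.+1 N a1 b1 c1 e1 /\ dfil (p + r) N a1 b1 c1 e1,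
      fil (p.+1 - r) (N - 1) a2 b2 c2 e2 /\ dfil p (N - 1) a2 b2 c2 e2,
      a = a1 + da (N - 1) a2 b2 c2, b = b1 + db (N - 1) b2 c2 e2
    & c = c1 + dc (N - 1) b2 c2 e2 /\ e = e1 + de (N - 1) e2].

Lemma tot_diff_fil p m a b c e : let N := m - (k + k) in
  fil 0 N a b c e ->
  tot_fil p (m + 1) (tot_diff A (tot_elt m a b c e)) <-> dfil p N a b c e.
Proof.
move=> N Fv; rewrite tot_diff_elt // tot_fil_elt; last first.
  by rewrite addrAC; exact: dfil0.
by rewrite addrAC.
Qed.

Lemma page_num_elt r p (q : int) a b c e : let N := p%:Z + q - (k + k) in
  fil 0 N a b c e ->
  tot_elt (p%:Z + q) a b c e \in page_num r p q <-> qnum r p N a b c e.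
Proof.
move=> N Fv; split=> [/page_numP[]|[Gv Dv]].
  by move=> /tot_fil_elt-/(_ Fv) Gv /tot_diff_fil-/(_ Fv).
by apply/page_numP; rewrite tot_fil_elt // tot_diff_fil.
Qed.

Lemma page_den_elt r p (q : int) a b c e : let N := p%:Z + q - (k + k) in
  fil 0 N a b c e ->
  tot_elt (p%:Z + q) a b c e \in page_den r p q <-> qden r p N a b c e.
Proof.
move=> N Fv; have NE : p%:Z + q - 1 - (k + k) = N - 1 by rewrite /N; lia.
split=> [/page_denP[y [z [Fy FDy Fz FDz]]]|].
  have [a1 [b1 [c1 [e1 [F1 yE]]]]] := tot_elt_surj (tot_filS (leq0n _) Fy).
  have [a2 [b2 [c2 [e2 [F2 zE]]]]] := tot_elt_surj (tot_filS (leq0n _) Fz).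
  move: Fy FDy Fz FDz; rewrite {}yE {}zE.
  rewrite NE in F2; move=> /tot_fil_elt-/(_ F1) Gy /tot_diff_fil-/(_ F1) Dy.
  move=> /tot_fil_elt; rewrite NE => /(_ F2) Gz.
  rewrite -{1}[p%:Z + q](subrK 1) => /tot_diff_fil; rewrite NE => /(_ F2) Dz.
  rewrite tot_diff_elt NE // subrK -tot_eltD.
  move=> /tot_elt_inj-/(_ Fv)[|-> -> -> ->].
    by apply: filD => //; have := dfil0 F2; rewrite /dfil subrK.
  by exists a1, b1, c1, e1, a2, b2, c2, e2.
move=> [a1 [b1 [c1 [e1 [a2 [b2 [c2 [e2 [[Gy Dy] [Gz Dz] aE bE [cE eE]]]]]]]]]].
have F1 := filS (leq0n _) Gy; have F2 := filS (leq0n _) Gz.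
apply/page_denP; exists (tot_elt (p%:Z + q) a1 b1 c1 e1).
exists (tot_elt (p%:Z + q - 1) a2 b2 c2 e2).
split.
- exact/tot_fil_elt.
- exact/tot_diff_fil.
- by apply/tot_fil_elt; rewrite NE.
- rewrite -{1}[p%:Z + q](subrK 1).
  by apply/tot_diff_fil; rewrite NE.
- by rewrite tot_diff_elt NE // subrK -tot_eltD aE bE cE eE.
Qed.

(** All groups of the pages 2 and 3 turn out to be cyclic, so that a generator
    and its order modulo qden describe them. *)
Lemma isog_page_cyclic r p (q : int) o a0 b0 c0 e0 :
  let N := p%:Z + q - (k + k) in
  (0 < o)%N -> qnum r p N a0 b0 c0 e0 ->
  (forall a b c e, qnum r p N a b c e ->
     exists z, qden r p N (a - a0 * z) (b - b0 * z) (c - c0 * z) (e - e0 * z)) ->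
  (forall z, qden r p N (a0 * z) (b0 * z) (c0 * z) (e0 * z) <-> (o %| z)%Z) ->
  isog (page A r p q) (Zmod o).
Proof.
move=> N o0 num0 gen ord; have F0 := filS (leq0n _) num0.1.
have filMz p' a b c e z : fil p' N a b c e -> 
    fil p' N (a * z) (b * z) (c * z) (e * z).
  move=> [Fa Fbc Fe]; split=> Np; first by rewrite Fa ?mul0r.
    by have [-> ->] := Fbc Np; rewrite !mul0r.
  by rewrite Fe ?mul0r.
apply: (@isog_subquot_cyclic _ _ _ _ (tot_elt (p%:Z + q) a0 b0 c0 e0)) => //.
- exact/page_num_elt.
- move=> x Zx; have [Fx _] := page_numP _ _ _ _ Zx.
  have [a [b [c [e [Fv xE]]]]] := tot_elt_surj (tot_filS (leq0n _) Fx).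
  move: Zx; rewrite {}xE => /page_num_elt-/(_ Fv)/gen[z Bz].
  exists z; rewrite -tot_eltMz -tot_eltB; apply/page_den_elt => //.
  by apply: filB => //; exact: filMz.
- move=> z; rewrite -ord -tot_eltMz page_den_elt //; exact: filMz.
Qed.

End TotalCoordinates.

(** * The pages 2 and 3 of the standard resolution *)

Ltac split_lia :=
  repeat match goal with
  | |- and _ _ => split
  | |- and3 _ _ _ => split
  | |- and5 _ _ _ _ _ => split
  | |- _ -> _ => intro
  end; lia.

Lemma even_half (n : nat) : ~~ odd n -> exists h : int, n%:Z = 2 * h.
Proof. by move=> ne; exists n./2%:Z; lia. Qed.

Lemma odd_half (n : nat) : odd n -> exists h : int, n%:Z = 2 * h + 1.
Proof. by move=> no; exists n./2%:Z; lia. Qed.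

Section Pages.
Variables (n : nat) (k : int).
Hypothesis n_gt0 : (0 < n)%N.

Let A := hom_double_complex std_resolution (D_complex n k).

Implicit Types (p r : nat) (q N a b c e : int).

Definition gcd2 : nat := if odd n then 1%N else 2%N.

Lemma qnum_den r p N a b c e :
  fil p.+1 N a b c e -> dfil n k (p + r) N a b c e -> qden n k r p N a b c e.
Proof.
move=> Fv Dv; exists a, b, c, e, 0, 0, 0, 0.
rewrite /dfil /da /db /dc /de !(mulr0, addr0, subr0, oppr0).
by split.
Qed.

Lemma isog_page0 r p q : let N := p%:Z + q - (k + k) in
  (forall a b c e, qnum n k r p N a b c e -> qden n k r p N a b c e) ->
  isog (page A r p q) (Zmod 1).
Proof.
move=> N numden; have den0 : qden n k r p N 0 0 0 0.
  apply: qnum_den; first exact: fil0.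
  by rewrite /dfil /da /db /dc /de !(mulr0, addr0, subr0, oppr0).
apply: (@isog_page_cyclic _ _ _ _ _ _ 0 0 0 0) => //.
- split; first exact: fil0.
  by rewrite /dfil /da /db /dc /de !(mulr0, addr0, subr0, oppr0).
- by move=> a b c e /numden vden; exists 0; rewrite !mul0r !subr0.
- by move=> z; rewrite !mul0r dvd1z.
Qed.

Lemma mulnz_eq0 e : n%:Z * e = 0 -> e = 0.
Proof. by move=> /eqP; rewrite mulf_eq0 => /orP[|/eqP//]; lia. Qed.

(** Above the row 2 k all elements of the total degree already lie in F^{p+1}.
    In the row 2 k - 2 only the multiples of x (x) x remain, and the differential
    of the tensor square, which is a multiplication by n, is injective on
    them. *)
Lemma page_other_rows r p q : (1 < r)%N -> q != k + k -> q != k + k - 1 ->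
  isog (page A r p q) (Zmod 1).
Proof.
move=> r_gt1 q0 q1; apply: isog_page0; set N := _ - _ => a b c e [[Fa Fbc Fe] Dv].
have NE : N = p%:Z + (q - (k + k)) by rewrite /N addrA.
have [l_gt0|l_lt0] : 0 < q - (k + k) \/ q - (k + k) < -1 by lia.
  by apply: qnum_den => //; split=> ?; lia.
have a0 : a = 0 by apply: Fa; lia.
have [b0 c0] : b = 0 /\ c = 0 by apply: Fbc; lia.
have e0 : e = 0.
  have [/Fe//|le_p] := ltP (N + 2) p%:Z.
  have [_ Dbc _] := Dv; have [] := Dbc; first by lia.
  rewrite /db /dc b0 c0 => Db _; apply: mulnz_eq0; move: Db.
  by case: (sg_cases k) => ->; case: (sg_cases N) => ->; lia.
subst; apply: qnum_den => //; exact: fil0.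
Qed.

(** Here y (x) y is a cocycle. The denominator identifies it to zero modulo n,
    by the differential of the tensor square, and modulo 2, since twice y (x) y
    is up to sign the boundary of y (x) y placed in the previous column, which is
    absent for p = 0. *)
Lemma page_row0_same_sign r p : r = 2%N \/ r = 3%N -> sg k = sg p%:Z ->
  isog (page A r p (k + k)) (Zmod (if p == 0%N then n else gcd2)).
Proof.
move=> r23 kp.
apply: (@isog_page_cyclic _ _ _ _ _ _ 1 0 0 0); rewrite ?addrK.
- by rewrite /gcd2; case: ifP => // _; case: odd.
- rewrite /qnum /dfil /fil /da /db /dc /de kp.
  by split; split=> ?; lia.
- move=> a b c e [[Fa Fbc Fe] [Da Dbc De]]; exists a; apply: qnum_den.
    by split=> ?; lia.
  move: Da Dbc De; rewrite /dfil /fil /da /db /dc /de kp => Da Dbc De.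
  split=> h; [have := Da h|have := Dbc h|have := De h]; try lia.
- move=> z; rewrite !mul0r mul1r; split.
    move=> [a1 [b1 [c1 [e1 [a2 [b2 [c2 [e2 [[[Ha _ _] _] [[Ga Gbc _] _]]]]]]]]]].
    rewrite Ha; last by lia.
    rewrite /da sgB kp => zE _ _; case: eqP zE => [p0 zE|_ zE].
      move: zE; rewrite Ga; last by lia.
      case: (sg_cases p) => ->; set t := b2 + _ => zE.
        by apply/dvdzP; exists t; lia.
      by apply/dvdzP; exists (- t); lia.
    rewrite /gcd2; case: ifPn => [_|/even_half[h nE]]; first exact: dvd1z.
    move: zE; rewrite nE; case: (sg_cases p) => ->; set t := b2 + _ => zE.
      by apply/dvdzP; exists (a2 + h * t); lia.
    by apply/dvdzP; exists (- a2 - h * t); lia.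
  (* the boundaries of u y (x) y and of v x (x) y in the previous column *)
  have den u v : (p = 0%N -> u = 0) -> z = 2 * u + n%:Z * v ->
      qden n k r p p z 0 0 0.
    move=> pu zE.
    exists 0, v, (- sg p%:Z * v), 0, (sg p%:Z * u), (sg p%:Z * v), 0, 0.
    rewrite /dfil /fil /da /db /dc /de !sgB kp zE.
    by case: (sg_cases p) => ->; split_lia.
  case: eqP => [p0|p_neq0] /dvdzP[w zE]; first by apply: (den 0 w); lia.
  move: zE; rewrite /gcd2; case: ifPn => [/odd_half[h nE] _|ne zE].
    by apply: (den (- h * z) z); lia.
  by apply: (den w 0); lia.
Qed.

(** Up to F^{p+1}, the element is a coboundary of the tensor square as soon as n
    divides a; as 2 a = - n (b + (-1)^k c), this means that b + (-1)^k c is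
    even. *)
Lemma row0_opposite_den r p a b c e s : r = 2%N \/ r = 3%N ->
  sg k = - sg p%:Z -> qnum n k r p p a b c e -> b + sg k * c = - 2 * s ->
  qden n k r p p a b c e.
Proof.
move=> r23 kp [[Fa Fbc Fe] [Da Dbc De]] tE.
have aE : a = n%:Z * s.
  have := Da ltac:(lia); rewrite /da tE kp.
  by case: (sg_cases p) => ->; lia.
exists 0, (b + s), (c - sg p%:Z * s), e, 0, (sg p%:Z * s), 0, 0.
move: Da Dbc De tE; rewrite /dfil /fil /da /db /dc /de !sgB kp aE.
by case: (sg_cases p) => ->; split_lia.
Qed.

(** The coefficient a survives to the page 2 if 2 a is a multiple of n, and it is
    killed by the denominator if a itself is one. *)
Lemma page2_row0_opposite_sign p : sg k = - sg p%:Z ->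
  isog (page A 2 p (k + k)) (Zmod gcd2).
Proof.
move=> kp; have r23 : 2%N = 2%N \/ 2%N = 3%N by left.
rewrite /gcd2; case: ifPn => [/odd_half[h nE]|/even_half[h nE]].
  apply: isog_page0; rewrite addrK => a b c e num.
  have [[_ _ _] [Da _ _]] := num; have := Da ltac:(lia).
  rewrite /da kp => Da0.
  apply: (row0_opposite_den (s := a - h * (- (b + sg k * c)))) => //.
  move: Da0; rewrite nE kp; case: (sg_cases p) => ->; lia.
apply: (@isog_page_cyclic _ _ _ _ _ _ h (- 1) 0 0); rewrite ?addrK //.
- rewrite /qnum /dfil /fil /da /db /dc /de kp nE.
  by case: (sg_cases p) => ->; split_lia.
- move=> a b c e [[Fa Fbc Fe] [Da Dbc De]]; exists (- (b + sg k * c)).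
  move: Da Dbc De; rewrite /dfil /fil /da /db /dc /de kp => Da Dbc De.
  apply: qnum_den.
    move: (Da ltac:(lia)); rewrite nE /fil; case: (sg_cases p) => -> Da0.
      by split_lia.
    by split_lia.
  rewrite /dfil /fil /da /db /dc /de kp.
  move: (Da ltac:(lia)); rewrite nE; case: (sg_cases p) => -> Da0; split_lia.
- move=> z; split.
    move=> [a1 [b1 [c1 [e1 [a2 [b2 [c2 [e2 [[[Ha _ _] _] [[Ga Gbc _] _]]]]]]]]]].
    rewrite Ha; last by lia.
    rewrite /da sgB kp nE; set t := b2 + _ => zE _ _.
    apply/dvdzP; exists (sg p%:Z * t); move: zE; have : h != 0 by lia.
    by case: (sg_cases p) => ->; nia.
  move=> /dvdzP[w ->]; apply: (row0_opposite_den (s := w)) => //; last by lia.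
  rewrite /qnum /dfil /fil /da /db /dc /de kp nE.
  by case: (sg_cases p) => ->; split_lia.
Qed.

(** To survive to the page 3, an element must also have no boundary in the column
    p + 2; for n even this forces b + (-1)^k c to be even, which for n odd follows
    from 2 a = - n (b + (-1)^k c). In other terms d_2 sends the generator
    (n / 2) y (x) y - x (x) y of the page 2 to a generator of the row below. *)
Lemma page3_row0_opposite_sign p : sg k = - sg p%:Z ->
  isog (page A 3 p (k + k)) (Zmod 1).
Proof.
move=> kp; apply: isog_page0; rewrite addrK => a b c e num.
have [_ [Da Dbc _]] := num.
move: (Da ltac:(lia)) (Dbc ltac:(lia)); rewrite /da /db /dc kp => Da0 Dbc0.
have [s tE] : exists s, b + sg k * c = - 2 * s.
  rewrite kp; case: (boolP (odd n)) => [/odd_half|/even_half] [h nE].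
    exists (a - h * (- (b + sg k * c))); move: Da0; rewrite nE kp.
    by case: (sg_cases p) => ->; lia.
  exists (- (b - sg k * h * e)); move: Dbc0 => [+ _]; rewrite nE kp.
  by case: (sg_cases p) => ->; lia.
by apply: row0_opposite_den tE => //; right.
Qed.

Lemma row1_degE p : p%:Z + (k + k - 1) - (k + k) = p%:Z - 1.
Proof. by lia. Qed.

(** The numerator consists of the multiples of (0, (-1)^p n / 2, - n / 2, 1) for n
    even, and the boundary of x (x) x in the column p is twice this generator, up
    to sign. For n odd only the even multiples are integral. *)
Lemma page_row1_same_sign r p : r = 2%N \/ r = 3%N -> sg k = sg p%:Z ->
  isog (page A r p (k + k - 1)) (Zmod gcd2).
Proof.
move=> r23 kp; rewrite /gcd2; case: ifPn => [/odd_half[h nE]|/even_half[h nE]].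
  apply: isog_page0; rewrite row1_degE => a b c e [[Fa Fbc Fe] [Da Dbc De]].
  have a0 : a = 0 by apply: Fa; lia.
  move: (Da ltac:(lia)) (Dbc ltac:(lia)); rewrite /da /db /dc a0 sgB kp => Da0 Dbc0.
  have t0 : b + sg p%:Z * c = 0.
    by apply: mulnz_eq0; move: Da0; case: (sg_cases p) => ->; lia.
  exists 0, 0, 0, 0, 0, 0, 0, (sg p%:Z * h * e - b).
  move: t0 Dbc0; rewrite /dfil /fil /da /db /dc /de !sgB kp nE.
  case: (sg_cases p) => -> t0 Dbc0; split_lia.
apply: (@isog_page_cyclic _ _ _ _ _ _ 0 (sg p%:Z * h) (- h) 1) => //.
- rewrite row1_degE /qnum /dfil /fil /da /db /dc /de !sgB kp nE.
  by case: (sg_cases p) => ->; split_lia.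
- rewrite row1_degE => a b c e [[Fa Fbc Fe] [Da Dbc De]]; exists e.
  move: (Fa ltac:(lia)) (Da ltac:(lia)) (Dbc ltac:(lia)) De.
  rewrite /da /db /dc /de !sgB kp => a0 Da0 Dbc0 De0.
  have t0 : b + sg p%:Z * c = 0.
    by apply: mulnz_eq0; move: Da0; rewrite a0; case: (sg_cases p) => ->; lia.
  move: t0 Dbc0; rewrite nE => t0 Dbc0.
  have [-> -> ->] : [/\ b - sg p%:Z * h * e = 0, c - (- h) * e = 0 & e - 1 * e = 0].
    by move: t0 Dbc0; case: (sg_cases p) => -> t0 Dbc0; split_lia.
  apply: qnum_den; first by rewrite a0 mul0r subr0; exact: fil0.
  by rewrite a0 /dfil /fil /da /db /dc /de; split_lia.
- move=> z; rewrite row1_degE; split.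
    move=> [a1 [b1 [c1 [e1 [a2 [b2 [c2 [e2 [[[Ha Hbc _] [_ Dbc _]] _ _ _ [_ eE]]]]]]]]]].
    have e10 : e1 = 0.
      move: (Hbc ltac:(lia)) (Dbc ltac:(lia)) => [-> ->].
      rewrite /db !sgB kp => -[Db _]; apply: mulnz_eq0; move: Db.
      by case: (sg_cases p) => ->; lia.
    apply/dvdzP; exists (- sg p%:Z * e2); move: eE.
    by rewrite e10 /de !sgB kp; case: (sg_cases p) => ->; lia.
  move=> /dvdzP[w ->]; exists 0, 0, 0, 0, 0, 0, 0, (- sg p%:Z * w).
  rewrite /dfil /fil /da /db /dc /de !sgB kp nE.
  by case: (sg_cases p) => ->; split_lia.
Qed.

Lemma row1_opposite_num r p a b c e : (1 < r)%N -> sg k = - sg p%:Z ->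
  qnum n k r p (p%:Z - 1) a b c e -> [/\ a = 0, c = sg p%:Z * b & e = 0].
Proof.
move=> r_gt1 kp [[Fa _ _] [Da Dbc _]].
move: (Fa ltac:(lia)) (Da ltac:(lia)) (Dbc ltac:(lia)).
rewrite /da /db /dc !sgB kp => a0 Da0 Dbc0.
have t0 : b - sg p%:Z * c = 0.
  by apply: mulnz_eq0; move: Da0; rewrite a0; case: (sg_cases p) => ->; lia.
have e0 : e = 0.
  by apply: mulnz_eq0; move: Dbc0 t0; case: (sg_cases p) => ->; lia.
by move: t0; case: (sg_cases p) => ->; split_lia.
Qed.

(** Twice the cocycle (0, 1, (-1)^p, 0) is the boundary of
    (-1)^p x (x) y + y (x) x in the previous column, which requires p > 0, and n
    times the cocycle is the boundary of x (x) x. *)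
Lemma row1_opposite_den r p b u v : r = 2%N \/ r = 3%N ->
  sg k = - sg p%:Z -> (p = 0%N -> u = 0) -> b = 2 * u + n%:Z * v ->
  qden n k r p (p%:Z - 1) 0 b (sg p%:Z * b) 0.
Proof.
move=> r23 kp pu bE; exists 0, 0, 0, 0, 0, (sg p%:Z * u), u, v.
rewrite /dfil /fil /da /db /dc /de !sgB kp bE.
by case: (sg_cases p) => ->; split_lia.
Qed.

Lemma page_row1_opposite_sign r p : r = 2%N \/ r = 3%N /\ (p < 2)%N ->
  sg k = - sg p%:Z ->
  isog (page A r p (k + k - 1)) (Zmod (if p == 0%N then n else gcd2)).
Proof.
move=> rp kp; have r23 : r = 2%N \/ r = 3%N by lia.
apply: (@isog_page_cyclic _ _ _ _ _ _ 0 1 (sg p%:Z) 0).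
- by rewrite /gcd2; case: ifP => // _; case: odd.
- rewrite row1_degE /qnum /dfil /fil /da /db /dc /de !sgB kp.
  by case: (sg_cases p) => ->; split_lia.
- rewrite row1_degE => a b c e /row1_opposite_num[||-> -> ->] //; first by lia.
  exists b; rewrite !mul0r mul1r !subrr.
  by apply: qnum_den => //; rewrite /dfil /fil /da /db /dc /de; split_lia.
- move=> z; rewrite row1_degE !mul0r mul1r; split.
    move=> [a1 [b1 [c1 [e1 [a2 [b2 [c2 [e2 [[[Ha Hbc _] _] [[Ga Gbc _] [Da _ _]]]]]]]]]]].
    move: (Hbc ltac:(lia)) (Ga ltac:(lia)) (Da ltac:(lia)) => [-> _] ->.
    rewrite /da /db !sgB kp => Da0 _ zE _.
    have t0 : b2 - sg p%:Z * c2 = 0.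
      by apply: mulnz_eq0; move: Da0; case: (sg_cases p) => ->; lia.
    case: eqP => [p0|_].
      have [b20 c20] := Gbc ltac:(lia); apply/dvdzP; exists e2.
      by move: zE; rewrite b20 c20; case: (sg_cases p) => ->; lia.
    rewrite /gcd2; case: ifPn => [_|/even_half[h nE]]; first exact: dvd1z.
    apply/dvdzP; exists (c2 + h * e2); move: zE t0; rewrite nE.
    by case: (sg_cases p) => ->; lia.
  case: eqP => [p0|p_neq0] /dvdzP[w zE].
    by apply: (row1_opposite_den (u := 0) (v := w)) => //; lia.
  move: zE; rewrite /gcd2; case: ifPn => [/odd_half[h nE] _|ne zE].
    by apply: (row1_opposite_den (u := - h * z) (v := z)) => //; lia.
  by apply: (row1_opposite_den (u := w) (v := 0)) => //; lia.
Qed.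

(** For p > 1 there is an additional column on the left: on the page 3 the
    denominator contains the boundary of (n / 2) y (x) y + y (x) x up to signs,
    for n even, and this boundary is the cocycle itself, not its double. *)
Lemma page3_row1_opposite_sign p : (1 < p)%N -> sg k = - sg p%:Z ->
  isog (page A 3 p (k + k - 1)) (Zmod 1).
Proof.
move=> p_gt1 kp; apply: isog_page0; rewrite row1_degE.
move=> a b c e /row1_opposite_num[||-> -> ->] //.
case: (boolP (odd n)) => [/odd_half|/even_half] [h nE].
  apply: (row1_opposite_den (u := - h * b) (v := b)) => //; [by right| |]; lia.
exists 0, 0, 0, 0, (sg p%:Z * h * b), 0, b, 0.
rewrite /dfil /fil /da /db /dc /de !sgB kp nE.
by case: (sg_cases p) => ->; split_lia.
Qed.

End Pages.

(** * The spectral sequences for an arbitrary resolution *)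

Lemma sg_nat (p : nat) : sg p%:Z = if odd p then -1 else 1.
Proof. by rewrite /sg -[LHS]/((-1) ^+ p) -signr_odd; case: odd. Qed.

(** The cocycle is y (x) y. If n times it were the boundary of (0, b, c, e), then
    b + c = 1 and b - c = n e would hold; for n even this contradicts parity. *)
Lemma tot_coh_not_killed (n : nat) (k : int) :
  (0 < n)%N -> ~~ odd n -> sg k = 1 ->
  exists u : tot_coh (hom_double_complex std_resolution (D_complex n k)) 0
                     (k + k),
    u *+ n <> 0.
Proof.
move=> n_gt0 ne k1; have [h nE] := even_half ne.
pose x := tot_elt n k (k + k) 1 0 0 0.
have N0 : k + k - (k + k) = 0 by rewrite subrr.
have sg0 : sg 0 = 1 by [].
have x_fil : fil 0 (k + k - (k + k)) 1 0 0 0 by rewrite N0.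
have Zx : x \in cocycles 0 (k + k).
  apply/cocyclesP; split; first exact/tot_fil_elt.
  rewrite /x tot_diff_elt // N0 -(tot_elt0 n k (k + k + 1)).
  have -> : da n k 0 1 0 0 = 0 by rewrite /da k1 sg0; lia.
  have -> : db n k 0 0 0 0 = 0 by rewrite /db k1 sg0; lia.
  have -> : dc n 0 0 0 0 = 0 by rewrite /dc sg0; lia.
  by have -> : de k 0 0 = 0 by rewrite /de mulr0.
have Znx : x *~ n%:Z \in cocycles 0 (k + k) by exact: rpredMz.
exists (sqclass _ Zx).
rewrite pmulrn -(sqclassMz _ _ Znx).
move=> /sqclass_eq0/coboundariesP[z Fz].
have [a [b [c [e [Fv ->]]]]] := tot_elt_surj Fz.
have NE : k + k - 1 - (k + k) = - 1 by lia.
rewrite NE in Fv.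
rewrite tot_diff_elt NE // subrK -tot_eltMz !mul0r.
move=> /tot_elt_inj[]; rewrite ?N0 //.
have [Fa _ _] := Fv; have a0 : a = 0 by exact: Fa.
rewrite /da /db a0 k1 (_ : sg (- 1) = -1) // => nE1 b0 _ _.
have : b + 1 * c = 1.
  by apply/eqP; rewrite -subr_eq0; apply/eqP/(mulnz_eq0 n_gt0); lia.
by move: b0; rewrite nE; lia.
Qed.

Section ArbitraryResolution.
Variables (W : free_resolution) (n : nat) (k : int).

Let A := hom_double_complex W (D_complex n k).

Implicit Types (p r : nat) (q : int).

Definition page_order r p q : nat :=
  if q == k + k then
    if sg k == sg p%:Z then (if p == 0%N then n else gcd2 n)
    else if r == 2%N then gcd2 n else 1%N
  else if q == k + k - 1 then
    if sg k == sg p%:Z then gcd2 n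
    else if (r == 2%N) || (p < 2)%N then (if p == 0%N then n else gcd2 n)
    else 1%N
  else 1%N.

Lemma isog_page_std r p q : (1 < r)%N ->
  isog (page A r p q)
       (page (hom_double_complex std_resolution (D_complex n k)) r p q).
Proof.
by move=> r_gt1; apply: filtered_equiv_page => //; exact: resolution_invariance.
Qed.

Lemma D_bounded : fil_bounded A.
Proof.
move=> m; exists (absz (m - (k + k) + 3)) => x Fx.
apply: dprod_ext => i; apply: dprod_ext => j.
have [im|im] := boolP ((i < absz (m - (k + k) + 3)%R)%N || (i%:Z + j != m)).
  exact: Fx.
apply: homC2_ext => w; rewrite homC2_0.
rewrite [LHS]D_quad_surj -[RHS](D_quad0 k j).
by apply/D_quad_eq; split; lia.
Qed.

Hypothesis n_gt0 : (0 < n)%N.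

Lemma isog_page_order r p q : r = 2%N \/ r = 3%N ->
  isog (page A r p q) (Zmod (page_order r p q)).
Proof.
move=> r23; apply: isog_trans (isog_page_std p q _) _; first by lia.
have sg_opp : sg k != sg p%:Z -> sg k = - sg p%:Z.
  by case: (sg_cases k) => ->; case: (sg_cases p) => ->; lia.
rewrite /page_order; have [->|q0] := eqVneq q (k + k).
  have [kp|/sg_opp kp] := eqVneq; first exact: page_row0_same_sign.
  case: r23 => -> /=; first exact: page2_row0_opposite_sign.
  exact: page3_row0_opposite_sign.
have [->|q1] := eqVneq q (k + k - 1); last first.
  by apply: page_other_rows => //; lia.
have [kp|/sg_opp kp] := eqVneq; first exact: page_row1_same_sign.
case: ifPn => [r2|]; first by apply: page_row1_opposite_sign => //; lia.
rewrite negb_or => /andP[r2 p2]; have -> : r = 3%N by lia.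
by apply: page3_row1_opposite_sign => //; lia.
Qed.

Lemma page_other_eq0 r p q : (1 < r)%N -> q != k + k -> q != k + k - 1 ->
  forall u : page A r p q, u = 0.
Proof.
move=> r_gt1 q0 q1; apply: isog_Zmod1.
exact: isog_trans (isog_page_std p q r_gt1) (page_other_rows _ _ _ _ _).
Qed.

Lemma page_order1_eq0 r p q : r = 2%N \/ r = 3%N -> page_order r p q = 1%N ->
  forall u : page A r p q, u = 0.
Proof. by move=> /(isog_page_order p q) + o1; rewrite o1; exact: isog_Zmod1. Qed.

(** There are only two rows, so that the differentials of the page 3 and after
    vanish for lack of room. *)
Lemma D_collapses3 : collapses_at A 3.
Proof.
move=> s s_ge3 p q u.
have [q0|q0] := boolP ((q == k + k) || (q == k + k - 1)).
  by apply: page_other_eq0; lia.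
rewrite (_ : u = 0) ?raddf0 //; apply: page_other_eq0; lia.
Qed.

Lemma D_collapses2 : odd n -> collapses_at A 2.
Proof.
move=> n_odd s s_ge2 p q u.
have [s2|s2] := eqVneq s 2%N; last by apply: D_collapses3; lia.
move: u; rewrite s2 => u; have [q0|q0] := eqVneq q (k + k).
  apply: page_order1_eq0; first by left.
  rewrite /page_order /gcd2 n_odd addn2 /=.
  by do !case: ifP => //.
have [q1|q1] := eqVneq q (k + k - 1).
  by apply: page_other_eq0; lia.
by rewrite (_ : u = 0) ?raddf0 //; apply: page_other_eq0.
Qed.

Lemma D_trivial_ext r p q : r = 2%N \/ r = 3%N -> collapses_at A r ->
  page_order r p q = 1%N \/
  (forall p' (q' : int), (p < p')%N -> p'%:Z + q' = p%:Z + q ->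
     page_order r p' q' = 1%N) ->
  trivial_ext A r p q.
Proof.
move=> r23 Ar o1; have [g gext] := collapse_filtration_ext D_bounded p q Ar.
exists g; split=> //; case: o1 => o1.
  by apply: splits_eq0; exact: page_order1_eq0.
apply: splits_ker0 gext.2 _.
apply: (tot_coh_eq0 (r := r)); first exact: D_bounded.
by move=> p' q' pp' deg; apply: page_order1_eq0 => //; exact: o1.
Qed.

End ArbitraryResolution.

(** * The two families of spectral sequences *)

Lemma page_order_k0 (n r i : nat) (j : int) :
  page_order n 0 r i j =
  if j == 0 then
    if odd i then (if r == 2%N then gcd2 n else 1%N)
    else (if i == 0%N then n else gcd2 n)
  else if j == -1 then
    if odd i then (if (r == 2%N) || (i < 2)%N then gcd2 n else 1%N)
    else gcd2 n
  else 1%N.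
Proof.
rewrite /page_order sg_nat -[sg 0]/(1 : int) -[0 + 0 : int]/(0 : int).
rewrite -[0 - 1 : int]/(- 1 : int).
by case: i => [|i] //; case: (odd _).
Qed.

Lemma page_order_k1 (n r i : nat) (j : int) :
  page_order n 1 r i j =
  if j == 2 then
    if odd i then gcd2 n else (if r == 2%N then gcd2 n else 1%N)
  else if j == 1 then
    if odd i then gcd2 n
    else if (r == 2%N) || (i < 2)%N then (if i == 0%N then n else gcd2 n)
    else 1%N
  else 1%N.
Proof.
rewrite /page_order sg_nat -[sg 1]/(- 1 : int) -[1 + 1 : int]/(2 : int).
rewrite -[2 - 1 : int]/(1 : int).
by case: i => [|i] //; case: (odd _).
Qed.

Theorem theorem5 (W : free_resolution) (n : nat) (n_gt0 : (0 < n)%N) :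
  let A := hom_double_complex W (D_complex n 0) in
  let A' := hom_double_complex W (D_complex n 1) in
  (odd n ->
    [/\ forall (i : nat) (j : int), isog (page A 2 i j)
          (Zmod (if (i == 0%N) && (j == 0) then n else 1%N)),
        forall (i : nat) (j : int), isog (page A' 2 i j)
          (Zmod (if (i == 0%N) && (j == 1) then n else 1%N)),
        collapses_at A 2 /\ collapses_at A' 2
      & forall (i : nat) (j : int),
          trivial_ext A 2 i j /\ trivial_ext A' 2 i j])
  /\
  (~~ odd n ->
    [/\ (forall (i : nat) (j : int), isog (page A 2 i j)
           (Zmod (if (i == 0%N) && (j == 0) then n
                  else if (j == -1) || (j == 0) && (0 < i)%N then 2%N
                  else 1%N)))
        /\
        (forall (i : nat) (j : int), isog (page A' 2 i j)
           (Zmod (if (i == 0%N) && (j == 1) then n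
                  else if (j == 2) || (j == 1) && (0 < i)%N then 2%N
                  else 1%N))),
        collapses_at A 3 /\ collapses_at A' 3,
        (forall (i : nat) (j : int), isog (page A 3 i j)
           (Zmod (if (i == 0%N) && (j == 0) then n
                  else if [|| (i == 0%N) && (j == -1), (i == 1%N) && (j == -1)
                            | [&& (0 < i)%N, ~~ odd i & (j == 0) || (j == -1)]]
                  then 2%N
                  else 1%N)))
        /\
        (forall (i : nat) (j : int), isog (page A' 3 i j)
           (Zmod (if (i == 0%N) && (j == 1) then n
                  else if odd i && ((j == 1) || (j == 2)) then 2%N
                  else 1%N))),
        (forall (i : nat) (j : int), (i, j) <> (0%N, 0) -> trivial_ext A 3 i j)
        /\
        (forall (i : nat) (j : int), trivial_ext A' 3 i j)
      & exists (f : {additive page A 3 1 (-1) -> tot_coh A 0 0})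
               (g : {additive tot_coh A 0 0 -> page A 3 0 0}),
          [/\ induced_by_id f, induced_by_id g, short_exact f g & ~ splits g]]).
Proof.
move=> A A'.
have pA r i j : r = 2%N \/ r = 3%N ->
    isog (page A r i j) (Zmod (page_order n 0 r i j)).
  exact: isog_page_order.
have pA' r i j : r = 2%N \/ r = 3%N ->
    isog (page A' r i j) (Zmod (page_order n 1 r i j)).
  exact: isog_page_order.
have two : 2%N = 2%N \/ 2%N = 3%N by left.
have three : 3%N = 2%N \/ 3%N = 3%N by right.
split=> [no|ne].
  split=> [i j|i j||i j].
  - have := pA 2%N i j two; rewrite page_order_k0 /gcd2 no.
    by do !case: ifP => //; lia.
  - have := pA' 2%N i j two; rewrite page_order_k1 /gcd2 no.
    by do !case: ifP => //; lia.
  - by split; exact: D_collapses2.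
  - split; apply: D_trivial_ext => //; try exact: D_collapses2.
      have [ij|ij] := boolP ((i == 0%N) && (j == 0)); [right=> p' q' pp' deg|left];
        by rewrite page_order_k0 /gcd2 no; do !case: ifP => //; lia.
    have [ij|ij] := boolP ((i == 0%N) && (j == 1)); [right=> p' q' pp' deg|left];
      by rewrite page_order_k1 /gcd2 no; do !case: ifP => //; lia.
have g2 : gcd2 n = 2%N by rewrite /gcd2 (negbTE ne).
split.
- split=> i j; [have := pA 2%N i j two|have := pA' 2%N i j two];
    rewrite ?page_order_k0 ?page_order_k1 g2; do !case: ifP => //; lia.
- by split; exact: D_collapses3.
- split=> i j; [have := pA 3%N i j three|have := pA' 3%N i j three];
    rewrite ?page_order_k0 ?page_order_k1 g2; do !case: ifP => //; lia.
- split=> i j; last first.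
    apply: D_trivial_ext => //; first exact: D_collapses3.
    have [ij|ij] := boolP (((i == 0%N) || odd i) && (j == 1) || (j == 2) && odd i);
      [right=> p' q' pp' deg|left];
      by rewrite page_order_k1 g2; do !case: ifP => //; lia.
  move=> ij0; have {}ij0 : ~~ ((i == 0%N) && (j == 0)).
    by apply/negP => /andP[/eqP i0 /eqP j0]; apply: ij0; rewrite i0 j0.
  apply: D_trivial_ext => //; first exact: D_collapses3.
  have [ij|ij] := boolP ((j == -1) || (j == 0) && ~~ odd i);
    [right=> p' q' pp' deg|left];
    by rewrite page_order_k0 g2; do !case: ifP => //; lia.
- have F2 : forall u : tot_coh A 2 0, u = 0.
    apply: (tot_coh_eq0 (r := 3)) => [|p' q' pp' deg]; first exact: D_bounded.
    apply: page_order1_eq0 => //.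
    by rewrite page_order_k0 g2; do !case: ifP => //; lia.
  have [f [g [f_id g_id fg]]] := two_step_extension (D_bounded W n 0)
    (p := 0) (q := 0) (q' := -1) (m := 0) (@D_collapses3 W n 0 n_gt0) erefl erefl F2.
  exists f, g; split=> // g_split.
  have [u nu] := tot_coh_not_killed n_gt0 ne (erefl : sg 0 = 1).
  have /isog_mulrn_eq0 := filtered_equiv_coh 0
    (resolution_invariance (D_complex n 0) std_resolution W).
  move=> /(_ n) nA; apply/nu/nA; apply: (splits_mulrn_eq0 fg g_split).
    have := pA 3%N 1%N (-1) three; rewrite page_order_k0 g2 /= => pZ2 a.
    have -> : a *+ n = a *+ 2 *+ n./2.
      by rewrite -mulrnA; congr (_ *+ _); lia.
    by rewrite (isog_Zmod_mulrn _ pZ2) // mul0rn.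
  have := pA 3%N 0%N 0 three; rewrite page_order_k0 g2 /= => pZn c.
  exact: isog_Zmod_mulrn pZn c.
Qed.
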